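(* Consider the quantized ARX setting described in the context and suppose Assumptions (A1)–(A4) and (A6) hold. Let $c>0$ be the constant of (A3) and $c_2>0$ the constant of (A6). Let $c_4>0$ be a constant such that, almost surely, $\lambda^{(p^*,q_0)}_{max}(n)\le c_4(n+1)$ for all sufficiently large $n$, and let $\gamma'$ be a constant such that, almost surely, $\|\tilde\theta_n(q)\|\le\gamma'$ for all sufficiently large $n$ and every $0\le q\le q_0$. Let $\beta_1>0$ and $0<\beta_2<1$, and let the sequence $(v_n)$ satisfy $$\bigl[5(1+p^*c)\varepsilon+\beta_1\bigr]n\;\le\; v_n\;\le\;\frac{\beta_2}{q^*}\Bigl[b_{q_0}^2c_2-2\gamma'\sqrt{c_4(1+p^*c)\varepsilon}-3(1+p^*c)\varepsilon\Bigr]n .$$ Define $V_n(p,q):=\sigma_n(p,q)+v_n\,(p+q)$ and $\hat q_n:=\mathrm{argmin}_{0\le q\le q^*}V_n(p^*,q)$. Then $\hat q_n\to q_0$ almost surely as $n\to\infty$.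
   Context: System: $A(z)y_{n+1}=B(z)u_n+w_{n+1}$, $n\ge0$, where $z$ is the backward shift operator, $A(z)=1+a_1z+\dots+a_{p_0}z^{p_0}$ ($p_0\ge0$), $B(z)=b_1+b_2z+\dots+b_{q_0}z^{q_0-1}$ ($q_0\ge1$), $a_{p_0}\ne0$, $b_{q_0}\ne0$; i.e. $y_{n+1}=-a_1y_n-\dots-a_{p_0}y_{n-p_0+1}+b_1u_n+\dots+b_{q_0}u_{n-q_0+1}+w_{n+1}$. The parameters and orders are unknown. The noise $\{w_n\}$ is i.i.d. with $w_n\sim N(0,1)$, and $y_n=u_n=w_n=0$ for $n<0$. Given a quantization step $\varepsilon>0$, only $s_n=\varepsilon\lfloor y_n/\varepsilon+1/2\rfloor$ is observed. For integers $p,q\ge0$ define $\psi_i(p,q)=[s_i,\dots,s_{i-p+1},u_i,\dots,u_{i-q+1}]^\top$, where $s_i=u_i=0$ when $i\le0$, and $P_{n+1}(p,q)=\bigl(I+\sum_{i=0}^n\psi_i(p,q)\psi_i(p,q)^\top\bigr)^{-1}$; $\lambda^{(p,q)}_{min}(n)$, $\lambda^{(p,q)}_{max}(n)$ are the smallest and largest eigenvalues of $P^{-1}_{n+1}(p,q)$. Define $\bar\theta(p,q)=[-a_1,\dots,-a_p,b_1,\dots,b_q]^\top$ with $a_i=0$ for $i>p_0$, $b_j=0$ for $j>q_0$. Least squares estimate: $\theta_n(p,q)=P_n(p,q)\sum_{i=0}^{n-1}\psi_i(p,q)s_{i+1}$; $\sigma_n(p,q)=\sum_{i=0}^{n-1}(s_{i+1}-\theta_n(p,q)^\top\psi_i(p,q))^2$.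 For $0\le q\le q_0$, writing $\theta_n(p^*,q)=[-a_{1n}(q),\dots,-a_{p^*n}(q),b_{1n}(q),\dots,b_{qn}(q)]^\top$, set $\hat\theta_n(q)=[-a_{1n}(q),\dots,-a_{p^*n}(q),b_{1n}(q),\dots,b_{qn}(q),0,\dots,0]^\top$ (with $q_0-q$ zeros) and $\tilde\theta_n(q)=\bar\theta(p^*,q_0)-\hat\theta_n(q)$. Assumptions: (A1) $\{u_i\}$ is i.i.d., uniform on $[-\delta,\delta]$, $\delta>0$. (A2) $A(z)\ne0$ for all $|z|\le1$. (A3) There is $c>0$ with $|a_i|\le c$, $|b_j|\le c$ for all $i\le p_0$, $j\le q_0$, and $\varepsilon<\frac{1}{2(1+p_0c)}$. (A4) $(p_0,q_0)\in\{(p,q):0\le p\le p^*,1\le q\le q^*\}$ for known integers $p^*,q^*>0$. (A6) There is $c_2>0$ such that for all $0\le q\le q^*$, almost surely $\lambda^{(p^*,q)}_{min}(n)\ge c_2(n+1)$ for all sufficiently large $n$.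
   Formalization: The input sequence (u_n) is additionally assumed independent of the noise (w_n); without this the claim fails, e.g. for inputs u_n = 2Φ(w_{n+2}) − 1 that anticipate the noise. *)

(* Defs.v *)
From HB Require Import structures.
From mathcomp Require Import all_boot all_order all_algebra.
From mathcomp Require Import all_classical all_reals all_analysis.
From mathcomp Require Import complex.

Set Implicit Arguments.
Unset Strict Implicit.
Unset Printing Implicit Defensive.

Import Order.TTheory GRing.Theory Num.Theory.
Local Open Scope ring_scope.
Local Open Scope classical_set_scope.

Definition mutually_independent {d} {T : measurableType d} {R : realType}
  (P : probability T R) {I : eqType} (X : I -> T -> R) : Prop :=
  forall (J : seq I) (B : I -> set R), uniq J -> (forall i, measurable (B i)) ->
    P (\bigcap_(i in [set i | i \in J]) (X i @^-1` B i)) =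
    (\big[*%E/1%E]_(i <- J) P (X i @^-1` B i))%E.

Definition has_law {d} {T : measurableType d} {R : realType}
  (P : probability T R) (X : T -> R) (mu : set R -> \bar R) : Prop :=
  forall A : set R, measurable A -> P (X @^-1` A) = mu A.

Section LS.
Variable R : realType.

(* f_{i-k}, with the convention f_j = 0 for j <= 0 *)
Definition reg (f : nat -> R) (i k : nat) : R := if (k < i)%N then f (i - k)%N else 0.

Definition psi (s u : nat -> R) (p q i : nat) : 'cV[R]_(p + q) :=
  col_mx (\col_(k < p) reg s i k) (\col_(k < q) reg u i k).

Definition Pinv (s u : nat -> R) (p q n : nat) : 'M[R]_(p + q) :=
  1%:M + \sum_(i < n) (psi s u p q i *m (psi s u p q i)^T).

Definition theta (s u : nat -> R) (p q n : nat) : 'cV[R]_(p + q) :=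
  invmx (Pinv s u p q n) *m \sum_(i < n) (s i.+1 *: psi s u p q i).

Definition sigma (s u : nat -> R) (p q n : nat) : R :=
  \sum_(i < n) (s i.+1 - ((theta s u p q n)^T *m psi s u p q i) 0 0) ^+ 2.

(* smallest / largest eigenvalue of P_{n+1}(p,q)^{-1} (a symmetric positive definite matrix) *)
Definition lambda_min (s u : nat -> R) (p q n : nat) : R :=
  inf [set a : R | eigenvalue (Pinv s u p q n.+1) a].
Definition lambda_max (s u : nat -> R) (p q n : nat) : R :=
  sup [set a : R | eigenvalue (Pinv s u p q n.+1) a].

Definition cv_get m (v : 'cV[R]_m) (k : nat) : R :=
  if @insub _ (fun j => (j < m)%N) 'I_m k is Some j then v j 0 else 0.

(* entries of theta_bar(pstar, q0) = [-a_1..-a_pstar, b_1..b_q0], a_i = 0 for i > p0 *)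
Definition theta_bar (p0 : nat) (a b : nat -> R) (pstar : nat) (k : nat) : R :=
  if (k < pstar)%N then - (if (k.+1 <= p0)%N then a k.+1 else 0) else b (k - pstar).+1.

Definition theta_tilde_norm (s u : nat -> R) (p0 : nat) (a b : nat -> R)
  (pstar q0 q n : nat) : R :=
  Num.sqrt (\sum_(k < pstar + q0)
     (theta_bar p0 a b pstar k - cv_get (theta s u pstar q n) k) ^+ 2).

Definition quantize (eps y : R) : R := eps * (Num.floor (y / eps + 2^-1))%:~R.

Definition Apoly (p0 : nat) (a : nat -> R) : {poly R[i]} :=
  \poly_(i < p0.+1) (if i == 0%N then 1 else ((a i)%:C)%C).

End LS.

(* Main.v *)
(** Write [h = (1 + pstar c) eps].  The quantized output satisfies a linear regression on its own
past and on the inputs, with noise [w + eta], where the quantization residual [eta] has energy at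
most [h n] over [n] steps.  Everything then follows from the strong law
[sum_(i < n) psi_i w_(i+1) = o(n)].  If [q > q0], least squares with extra regressors lowers the
residual sum of squares by at most [2 h n + o(n)], less than the extra penalty.  If [q < q0],
dropping the coefficient [b q0] raises it by at least
[(b q0 ^ 2 c2 - 2 gam sqrt (c4 h)) n - o(n)], more than the penalty saved.

The strong law needs no moment bound on the output.  Since [exp (l x - l^2 / 2)] times the standard
Gaussian density is the density of [N(l, 1)], the process
[exp (sum xi_i w_(i+1) - sum xi_i^2 / 2)] has mean [1] for every adapted [xi].  When
[sum_(i < n) xi_i^2 <= K n] this gives exponentially small deviation probabilities, and
Borel-Cantelli applies.  The upper bound on the largest eigenvalue supplies, along almost every
path, some [K] for the regressors. *)

Require Import Defs.
From HB Require Import structures.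
From mathcomp Require Import all_boot all_order all_algebra.
From mathcomp Require Import all_classical all_reals all_analysis.
From mathcomp Require Import complex measurable_realfun ring lra.
Import Order.TTheory GRing.Theory Num.Theory.
Import HBNNSimple.
Import numFieldNormedType.Exports.
Local Open Scope ring_scope.
Local Open Scope classical_set_scope.

Set Implicit Arguments.
Unset Strict Implicit.
Unset Printing Implicit Defensive.

(** * Gaussian exponential moments *)

(** By monotone convergence along simple approximations of [f], both sides reduce to indicators,
    where the claim is the hypothesis on [nu]. *)
Lemma ge0_integral_density d (T : measurableType d) (R : realType)
    (mu nu : {measure set T -> \bar R}) (g : T -> R) (f : T -> \bar R) :
  measurable_fun setT g -> (forall x, 0 <= g x) ->
  (forall A, measurable A -> nu A = \int[mu]_(x in A) (g x)%:E)%E ->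
  measurable_fun setT f -> (forall x, 0 <= f x)%E ->
  (\int[nu]_x f x = \int[mu]_x (f x * (g x)%:E))%E.
Proof.
move=> /measurable_EFinP mg g0 nuE mf f0.
pose f_ := nnsfun_approx measurableT mf.
transitivity (limn (fun n => \int[nu]_x (f_ n x)%:E))%E.
  rewrite -monotone_convergence//.
  - apply: eq_integral => y _; apply/esym/cvg_lim => //.
    by apply: cvg_nnsfun_approx => // *; apply: f0.
  - by move=> n; exact/measurable_EFinP/measurable_funP.
  - by move=> n y _; rewrite lee_fin.
  - by move=> y _ m n mn; rewrite lee_fin; exact/lefP/nd_nnsfun_approx.
transitivity (limn (fun n => \int[mu]_x ((f_ n x)%:E * (g x)%:E)))%E; last first.
  rewrite -monotone_convergence//.
  - apply: eq_integral => y _; apply/cvg_lim => //.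
    rewrite [X in _ --> X]muleC.
    under eq_fun do rewrite muleC.
    have := @cvg_nnsfun_approx _ _ _ _ measurableT _ mf (fun x _ => f0 x) y I.
    by move=> fy; exact: cvgeZl.
  - by move=> n; apply: emeasurable_funM => //; exact/measurable_EFinP/measurable_funP.
  - by move=> n y _; rewrite mule_ge0// lee_fin.
  - move=> y _ m n mn; apply: lee_wpmul2r; first by rewrite lee_fin.
    by rewrite lee_fin; exact/lefP/nd_nnsfun_approx.
congr (limn _); apply/funext => n.
have mfn r : measurable (f_ n @^-1` [set r]).
  by rewrite -[X in measurable X]setTI; exact: measurable_funP.
transitivity (\sum_(k \in range (f_ n)) \int[nu]_x (k * \1_(f_ n @^-1` [set k]) x)%:E)%E.
  under eq_integral do rewrite fimfunE -fsumEFin//.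
  rewrite ge0_integral_fsum//.
  - by move=> y; exact/measurable_EFinP/measurable_funM.
  - by move=> y x _; rewrite EFinM nnfun_muleindic_ge0.
transitivity (\sum_(k \in range (f_ n))
    \int[mu]_x ((k * \1_(f_ n @^-1` [set k]) x)%:E * (g x)%:E))%E; last first.
  rewrite -ge0_integral_fsum//.
  - apply: eq_integral => x _; rewrite fimfunE -fsumEFin// ge0_mule_fsuml//.
    by move=> r; rewrite EFinM nnfun_muleindic_ge0.
  - move=> y; apply: emeasurable_funM => //.
    exact/measurable_EFinP/measurable_funM.
  - by move=> y x _; apply: mule_ge0; rewrite ?EFinM ?nnfun_muleindic_ge0// lee_fin.
apply: eq_fsbigr => r _; rewrite integralZl_indic_nnsfun// integral_indic//= setIT nuE//.
(* [f_ n] is nonnegative, so a negative level [r] has empty preimage; taking the factor out of the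
   integral is done for [0 <= r]. *)
have [r0|r0] := ltP r 0.
  rewrite preimage_nnfun0// integral_set0 mule0 integral0_eq// => x _.
  by rewrite indic0 mulr0 mul0e.
under [RHS]eq_integral do rewrite EFinM -muleA.
rewrite ge0_integralZl//; last 2 first.
  - by apply: emeasurable_funM => //; exact/measurable_EFinP.
  - by move=> x _; rewrite mule_ge0// lee_fin.
congr (_ * _)%E; rewrite integral_mkcond; apply: eq_integral => x _.
by rewrite patchE indicE; case: ifPn => _; rewrite ?mul1e ?mul0e.
Qed.

Lemma integral_normal_mgf (R : realType) (l : R) :
  (\int[normal_prob 0 1]_x (expR (l * x - l ^+ 2 / 2))%:E = 1)%E.
Proof.
pose nu : {measure set _ -> \bar R} := normal_prob 0 1.
rewrite (@ge0_integral_density _ _ R lebesgue_measure nu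
  (normal_pdf 0 1))//.
(* Completing the square: [l x - l^2 / 2 - x^2 / 2 = - (x - l)^2 / 2]. *)
- rewrite -(integral_normal_pdf l 1); apply: eq_integral => x _.
  rewrite -EFinM !normal_pdfE ?oner_neq0//; congr EFin.
  rewrite mulrCA; congr (_ * _); rewrite /normal_fun -expRD; congr expR.
  by rewrite !expr1n; field.
- exact: measurable_normal_pdf.
- by move=> x; rewrite normal_pdf_ge0.
- apply/measurable_EFinP; apply: measurableT_comp => //.
  by apply: measurable_funB => //; exact: measurable_funM.
Qed.

(** * Independence and Tonelli *)

(** A pi-system for the sigma-algebra of the [X i] with [D i]. The lists are duplicate-free to match
    [mutually_independent]. *)
Definition cylinders T (I : choiceType) (R : realType) (X : I -> T -> R) (D : pred I) :
    set (set T) :=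
  [set A | exists J B, [/\ uniq J, all D J, forall i, measurable (B i) &
     A = \bigcap_(i in [set i | i \in J]) (X i @^-1` B i)]].

Lemma cylinders_setI_closed T (I : choiceType) (R : realType) (X : I -> T -> R) (D : pred I) :
  setI_closed (cylinders X D).
Proof.
move=> _ _ [J [B [_ DJ mB ->]]] [K [C [_ DK mC ->]]].
(* An index absent from one of the lists receives the trivial constraint [setT]. *)
exists (undup (J ++ K)), (fun i => (if i \in J then B i else setT) `&`
   (if i \in K then C i else setT)); split.
- exact: undup_uniq.
- apply/allP => i; rewrite mem_undup mem_cat => /orP[].
  + exact: (allP DJ).
  + exact: (allP DK).
- by move=> i; apply: measurableI; case: ifP.
- apply/seteqP; split => t /=.
  + move=> [tJ tK] i; rewrite /= mem_undup => _; split.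
    * by case: ifP => // iJ; exact: tJ.
    * by case: ifP => // iK; exact: tK.
  + move=> tJK; split => i /= iJ.
    * by have := tJK i; rewrite /= mem_undup mem_cat iJ => /(_ isT)[].
    * by have := tJK i; rewrite /= mem_undup mem_cat iJ orbT => /(_ isT)[].
Qed.

Lemma cylindersS T (I : choiceType) (R : realType) (X : I -> T -> R) (D D' : pred I) :
  subpred D D' -> cylinders X D `<=` cylinders X D'.
Proof.
move=> DD' A [J [B [uJ DJ mB ->]]]; exists J, B; split => //.
exact: sub_all DJ.
Qed.

Lemma cylinders_measurable d (T : measurableType d) (I : choiceType) (R : realType)
    (X : I -> T -> R) (D : pred I) :
  (forall i, measurable_fun setT (X i)) ->
  <<s cylinders X D >> `<=` (measurable : set (set T)).
Proof.
move=> mX; apply: smallest_sub; first exact: sigma_algebra_measurable.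
move=> _ [J [B [_ _ mB ->]]]; apply: fin_bigcap_measurable; first exact: finite_seq.
by move=> i _; rewrite -[X in measurable X]setTI; exact: mX.
Qed.

(** As functions of [A], both sides are finite measures. They agree on cylinders, by independence
    along the list [k :: J], hence on the generated sigma-algebra. *)
Lemma mutually_independent_cylinders d (T : measurableType d) (R : realType)
    (P : probability T R) (I : choiceType) (X : I -> T -> R) (D : pred I) (k : I)
    (A : set T) (W : set R) :
  (forall i, measurable_fun setT (X i)) -> mutually_independent P X -> ~~ D k ->
  <<s cylinders X D >> A -> measurable W ->
  P (A `&` X k @^-1` W) = (P A * P (X k @^-1` W))%E.
Proof.
move=> mX PX Dk sA mW.
have mXW : measurable (X k @^-1` W).
  by rewrite -[X in measurable X]setTI; exact: mX.
have r0 : 0 <= fine (P (X k @^-1` W)) by exact: fine_ge0.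
pose m1 : {measure set T -> \bar R} := mrestr P mXW.
pose m2 : {measure set T -> \bar R} := mscale (NngNum r0) P.
suff : m1 A = m2 A.
  by rewrite /m1 /m2 /= /mrestr /mscale /= fineK ?fin_num_measure// muleC.
apply: (g_sigma_algebra_measure_unique (cylinders X D) _ (fun=> setT)) => //.
- move=> B GB; apply: cylinders_measurable => //.
  exact: sub_sigma_algebra GB.
- move=> _; exists [::], (fun=> setT); split => //.
  by apply/seteqP; split.
- by apply/seteqP; split => // x _; exists 0%N.
- exact: cylinders_setI_closed.
- move=> _ [J [B [uJ DJ mB ->]]].
  have kJ : k \notin J by apply: contra Dk => /(allP DJ).
  pose B' i := if i == k then W else B i.
  have mB' i : measurable (B' i) by rewrite /B'; case: ifP.
  have B'E i : i \in J -> B' i = B i.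
    by rewrite /B'; case: eqP => // -> kJ'; rewrite kJ' in kJ.
  have ukJ : uniq (k :: J) by rewrite /= kJ.
  rewrite /m1 /m2 /= /mrestr /mscale /= fineK ?fin_num_measure//.
  have B'k : B' k = W by rewrite /B' eqxx.
  have := PX _ _ ukJ mB'; rewrite big_cons B'k.
  rewrite (eq_big_seq (fun j => P (X j @^-1` B j))) => [|i /B'E -> //].
  rewrite -(PX _ _ uJ mB) => <-; congr (P _).
  apply/seteqP; split => t /=.
  + move=> [tJ tk] i; rewrite /= inE => /predU1P[->|iJ].
      by rewrite B'k.
    by rewrite B'E//; exact: tJ.
  + move=> tkJ; split.
      by move=> i /= iJ; rewrite -B'E//; apply: tkJ; rewrite /= inE iJ orbT.
    by have := tkJ k; rewrite /= mem_head B'k; exact.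
- by move=> _; rewrite /m1 /= /mrestr setTI ltey_eq fin_num_measure.
Qed.

(** The freezing lemma. The identity of [T] into the coarser space generated by [G] is independent
    of [X], so the pair has a product law and Tonelli applies; [F] may thus involve any number of
    quantities known to [G]. *)
Lemma integral_independent d d' (T : measurableType d) (Y : measurableType d') (R : realType)
    (P : probability T R) (nu : probability Y R) (G : set (set T)) (X : T -> Y)
    (F : g_sigma_algebraType G * Y -> \bar R) :
  <<s G >> `<=` (measurable : set (set T)) ->
  measurable_fun setT X ->
  (forall A W, <<s G >> A -> measurable W -> P (A `&` X @^-1` W) = (P A * nu W)%E) ->
  measurable_fun setT F -> (forall z, 0 <= F z)%E ->
  (\int[P]_t F (t, X t) = \int[P]_t \int[nu]_x F (t, x))%E.
Proof.
move=> GT mX indep mF F0.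
pose TG : measurableType _ := g_sigma_algebraType G.
have mid : measurable_fun setT (idfun : T -> TG).
  by move=> _ B mB; rewrite setTI; exact: GT.
have mpair : measurable_fun setT (fun t => (t, X t) : TG * Y).
  exact: measurable_fun_pair.
pose idG : {mfun T >-> TG} := HB.pack (idfun : T -> TG) (isMeasurableFun.Build _ _ _ _ _ mid).
pose pairG : {mfun T >-> (TG * Y)%type} :=
  HB.pack (fun t => (t, X t) : TG * Y) (isMeasurableFun.Build _ _ _ _ _ mpair).
have prodE : forall Z, measurable Z ->
    (distribution P idG \x nu)%E Z = distribution P pairG Z.
  by apply: product_measure_unique => A B mA mB; exact: indep.
have -> : (\int[P]_t F (t, X t) = \int[distribution P pairG]_z F z)%E.
  by rewrite ge0_integral_pushforward.
rewrite (eq_measure_integral (distribution P idG \x nu)%E); last first.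
  by move=> A mA _; exact: esym (prodE _ mA).
rewrite fubini_tonelli1// ge0_integral_pushforward//.
  exact: measurable_fun_fubini_tonelli_F.
by move=> t _; exact: integral_ge0.
Qed.

(** * A strong law for Gaussian innovations *)

Definition adapted T (R : realType) (G : nat -> set (set T)) (f : nat -> T -> R) :=
  forall n (B : set R), measurable B -> <<s G n >> (f n @^-1` B).

(** Passes to [measurable_fun] on the coarser space, where the closure lemmas for sums, products and
    compositions apply. *)
Lemma measurable_funG (T : pointedType) (R : realType) (G : set (set T)) (f : T -> R) :
  (forall B : set R, measurable B -> <<s G >> (f @^-1` B)) <->
  measurable_fun (setT : set (g_sigma_algebraType G)) f.
Proof.
split=> mf; first by move=> _ B mB; rewrite setTI; exact: mf.
by move=> B mB; rewrite -[X in _ X]setTI; exact: (mf (@measurableT _ _)).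
Qed.

(* Sigma-algebras are given by generators: [G n] generates the information available at time [n]. *)
Definition innovations d (T : measurableType d) (R : realType) (P : probability T R)
    (G : nat -> set (set T)) (w : nat -> T -> R) :=
  [/\ forall n, <<s G n >> `<=` (measurable : set (set T)),
      forall n, <<s G n >> `<=` <<s G n.+1 >>,
      adapted G w &
      forall n A W, <<s G n >> A -> measurable W ->
        P (A `&` w n.+1 @^-1` W) = (P A * normal_prob 0 1 W)%E].

Lemma ler_sum_nat_widen (R : numDomainType) (F : nat -> R) m n :
  (m <= n)%N -> (forall i, 0 <= F i) -> \sum_(i < m) F i <= \sum_(i < n) F i.
Proof.
move=> mn F0; rewrite -(subnKC mn) big_split_ord/= lerDl.
by apply: sumr_ge0.
Qed.

Section innovations.
Context d (T : measurableType d) (R : realType) (P : probability T R).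
Context (G : nat -> set (set T)) (w : nat -> T -> R) (HG : innovations P G w).

Lemma innovations_mono m n : (m <= n)%N -> <<s G m >> `<=` <<s G n >>.
Proof.
have [_ GS _ _] := HG.
elim: n => [|n IHn]; first by rewrite leqn0 => /eqP ->.
by rewrite leq_eqVlt => /predU1P[->//|]; rewrite ltnS => /IHn /subset_trans; exact.
Qed.

Lemma adapted_le (f : nat -> T -> R) m n : adapted G f -> (m <= n)%N ->
  measurable_fun (setT : set (g_sigma_algebraType (G n))) (f m).
Proof.
move=> Gf mn; apply/measurable_funG => B mB.
by apply: (innovations_mono mn); exact: Gf.
Qed.

Lemma adapted_measurable (f : nat -> T -> R) n : adapted G f -> measurable_fun setT (f n).
Proof.
have [GT _ _ _] := HG.
by move=> Gf _ B mB; rewrite setTI; apply: (GT n); exact: Gf.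
Qed.

Lemma innovations_sum_adapted (xi : nat -> T -> R) (h : R -> R -> R) n :
  measurable_fun setT (fun z : R * R => h z.1 z.2) -> adapted G xi ->
  measurable_fun (setT : set (g_sigma_algebraType (G n)))
    (fun t => \sum_(i < n) h (xi i t) (w i.+1 t)).
Proof.
have [_ _ Gw _] := HG => mh Gxi.
rewrite (_ : (fun _ => _) = (fun t => \sum_(i <- index_enum 'I_n) h (xi i t) (w i.+1 t)))//.
apply: measurable_sum => i.
have mp : measurable_fun (setT : set (g_sigma_algebraType (G n)))
    (fun t => (xi i t, w i.+1 t)).
  by apply: measurable_fun_pair; apply: adapted_le => //; exact: ltnW.
exact: (measurableT_comp mh mp).
Qed.

(* Integrability never enters: all integrands are nonnegative and Tonelli applies. *)
Lemma innovations_exp_martingale (xi : nat -> T -> R) n : adapted G xi ->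
  (\int[P]_t (expR (\sum_(i < n) (xi i t * w i.+1 t - xi i t ^+ 2 / 2)))%:E = 1)%E.
Proof.
move=> Gxi; have [GT GS Gw indep] := HG.
elim: n => [|n IHn].
  under eq_integral do rewrite big_ord0 expR0.
  by rewrite integral_cst//= mul1e probability_setT.
have mS := @innovations_sum_adapted xi (fun x y => x * y - x ^+ 2 / 2) n.
under eq_integral do rewrite big_ord_recr/= expRD.
(* [z.1] freezes what is known at time [n] and [z.2] is the fresh innovation; the inner Gaussian
   integral equals 1 for each frozen [xi n]. *)
pose F (z : g_sigma_algebraType (G n) * measurableTypeR R) :=
  (expR (\sum_(i < n) (xi i z.1 * w i.+1 z.1 - xi i z.1 ^+ 2 / 2)) *
   expR (xi n z.1 * z.2 - xi n z.1 ^+ 2 / 2))%:E.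
have m2 : measurable_fun setT (fun z : g_sigma_algebraType (G n) * measurableTypeR R => z.2 : R).
  have mid : measurable_fun setT (idfun : measurableTypeR R -> R).
    by move=> _ B mB; rewrite setTI.
  exact: (measurableT_comp mid (@measurable_snd _ _ _ _)).
have mxi1 : measurable_fun setT
    (fun z : g_sigma_algebraType (G n) * measurableTypeR R => xi n z.1).
  by apply: measurableT_comp => //; exact: adapted_le.
rewrite -[LHS]/(\int[P]_t F (t, w n.+1 t))%E.
pose nu : probability _ R := normal_prob 0 1.
rewrite (@integral_independent _ _ _ _ _ P nu (G n) (w n.+1) F (GT n))//.
- rewrite -[RHS]IHn; apply: eq_integral => t _.
  under eq_integral do rewrite /F /= EFinM.
  rewrite ge0_integralZl//=.
  + by rewrite integral_normal_mgf mule1.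
  + apply/measurable_EFinP; apply: measurableT_comp => //.
    by apply: measurable_funB => //; exact: measurable_funM.
- exact: adapted_measurable.
- exact: indep.
- apply/measurable_EFinP; apply: measurable_funM.
    apply: measurableT_comp => //.
    apply: (measurableT_comp (mS _ _)) => //.
    apply: measurable_funB; first exact: measurable_funM.
    by apply: measurable_funM => //; exact: measurable_funX.
  apply: measurableT_comp => //.
  apply: measurable_funB; first exact: measurable_funM.
  by apply: measurable_funM => //; exact: measurable_funX.
- by move=> z; rewrite lee_fin mulr_ge0// expR_ge0.
Qed.

(** Markov's inequality for the exponential martingale of [l xi]. The exponent [l e n - l^2 K n / 2]
    is largest at [l = e / K], with value [e^2 n / (2 K)]. *)
Lemma innovations_chernoff (xi : nat -> T -> R) (K e : R) n : adapted G xi ->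
  0 < K -> 0 < e -> (forall t, \sum_(i < n) xi i t ^+ 2 <= K * n%:R) ->
  (P [set t | (e * n%:R < \sum_(i < n) xi i t * w i.+1 t)%R] <=
    (expR (- (e ^+ 2 / (2 * K))) ^+ n)%:E)%E.
Proof.
move=> Gxi K0 e0 xiK; set A := [set t | _].
have [GT _ _ _] := HG.
have mh : measurable_fun setT (fun z : R * R => z.1 * z.2) by exact: measurable_funM.
have mA : measurable A.
  apply: (GT n).
  have /measurable_funG := @innovations_sum_adapted xi (fun x y => x * y) n mh Gxi.
  move=> /(_ `]e * n%:R, +oo[%classic (measurable_itv _)).
  by rewrite set_itvE.
pose zeta i t := e / K * xi i t.
have Gz : adapted G zeta.
  move=> m; apply/measurable_funG; apply: measurable_funM => //.
  exact: adapted_le.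
have mgE := innovations_exp_martingale n Gz.
set c := expR (e ^+ 2 / (2 * K)) ^+ n.
have c0 : 0 < c by rewrite exprn_gt0// expR_gt0.
have zA t : A t -> c <= expR (\sum_(i < n) (zeta i t * w i.+1 t - zeta i t ^+ 2 / 2)).
  move=> At; rewrite /c -expRM_natl ler_expR.
  have -> : \sum_(i < n) (zeta i t * w i.+1 t - zeta i t ^+ 2 / 2) =
    e / K * \sum_(i < n) xi i t * w i.+1 t - (e / K) ^+ 2 / 2 * \sum_(i < n) xi i t ^+ 2.
    rewrite sumrB !mulr_sumr; congr (_ - _); apply: eq_bigr => i _.
      by rewrite /zeta mulrA.
    by rewrite /zeta exprMn; ring.
  apply: (@le_trans _ _ (e / K * (e * n%:R) - (e / K) ^+ 2 / 2 * (K * n%:R))).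
    rewrite le_eqVlt; apply/orP; left; apply/eqP; field.
    by rewrite gt_eqF.
  apply: lerB.
    by rewrite ler_pM2l ?divr_gt0//; exact: ltW.
  by apply: ler_wpM2l => //; rewrite divr_ge0// sqr_ge0.
have mZ : measurable_fun setT
    (fun t => (expR (\sum_(i < n) (zeta i t * w i.+1 t - zeta i t ^+ 2 / 2)))%:E).
  have mS := @innovations_sum_adapted zeta (fun x y => x * y - x ^+ 2 / 2) n.
  apply/measurable_EFinP; apply: measurableT_comp => // _ B mB; rewrite setTI.
  apply: (GT n); apply/measurable_funG : B mB; apply: mS => //.
  apply: measurable_funB; first exact: measurable_funM.
  by apply: measurable_funM => //; exact: measurable_funX.
(* On [A] the integrand is at least [c], and its integral over the whole space is 1. *)
have cPA : (c%:E * P A <= 1)%E.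
  rewrite -mgE -integral_cst//.
  apply: (@le_trans _ _ (\int[P]_(t in A)
      (expR (\sum_(i < n) (zeta i t * w i.+1 t - zeta i t ^+ 2 / 2)))%:E)%E).
    apply: ge0_le_integral => //.
    - by move=> t _; rewrite lee_fin ltW.
    - exact: measurable_funTS.
  exact: ge0_subset_integral.
have -> : expR (- (e ^+ 2 / (2 * K))) ^+ n = c^-1 by rewrite expRN exprVn.
by rewrite -[leRHS]mule1 lee_pdivlMl.
Qed.

(** The bounds [r ^+ n] with [r < 1] are summable, so the limsup of the deviation events is the
    exceptional null set. *)
Lemma innovations_borel_cantelli (xi : nat -> T -> R) (K e : R) : adapted G xi ->
  0 < K -> 0 < e -> (forall n t, \sum_(i < n) xi i t ^+ 2 <= K * n%:R) ->
  {ae P, forall t, exists N, forall n, (N <= n)%N ->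
     \sum_(i < n) xi i t * w i.+1 t <= e * n%:R}.
Proof.
move=> Gxi K0 e0 xiK.
pose A n := [set t | (e * n%:R < \sum_(i < n) xi i t * w i.+1 t)%R].
have [GT _ _ _] := HG.
have mh : measurable_fun setT (fun z : R * R => z.1 * z.2) by exact: measurable_funM.
have mA n : measurable (A n).
  apply: (GT n).
  have /measurable_funG := @innovations_sum_adapted xi (fun x y => x * y) n mh Gxi.
  move=> /(_ `]e * n%:R, +oo[%classic (measurable_itv _)).
  by rewrite set_itvE.
set r := expR (- (e ^+ 2 / (2 * K))).
have r0 : 0 < r by exact: expR_gt0.
have r1 : r < 1 by rewrite expR_lt1 oppr_lt0 divr_gt0 ?exprn_gt0 ?mulr_gt0.
have PA n : (P (A n) <= (r ^+ n)%:E)%E by exact: innovations_chernoff.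
have PA0 : P (lim_sup_set A) = 0%E.
  apply: lim_sup_set_cvg0 => //.
  apply: (@le_lt_trans _ _ (1 - r)^-1%:E); last exact: ltry.
  apply: lime_le; first exact: is_cvg_nneseries.
  apply: nearW => n; apply: (@le_trans _ _ (\sum_(0 <= i < n) (r ^+ i)%:E)%E).
    by apply: lee_sum => i _; exact: PA.
  rewrite sumEFin lee_fin.
  have -> : \sum_(0 <= i < n) r ^+ i = (1 - r ^+ n) / (1 - r).
    have /(congr1 (fun f => f n)) := @geometric_seriesE R 1 r (negbT (lt_eqF r1)).
    rewrite /series /= mul1r => <-; apply: eq_bigr => i _.
    by rewrite mul1r.
  apply: ler_piMl; first by rewrite invr_ge0 subr_ge0 ltW.
  by rewrite gerBl exprn_ge0// ltW.
exists (lim_sup_set A); split => //.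
  by apply: bigcap_measurableType => n _; exact: bigcup_measurable.
move=> t /= Ht n _; apply: contrapT => HA; apply: Ht; exists n => m nm.
by rewrite leNgt; apply/negP => tA; apply: HA; exists m.
Qed.

(** [K] may depend on the path: the exceptional null set is a countable union over truncation
    levels, tolerances [1 / (m + 1)] and both signs. *)
Lemma innovations_lln (f : nat -> T -> R) : adapted G f ->
  {ae P, forall t,
    (exists K N, forall n, (N <= n)%N -> \sum_(i < n) f i t ^+ 2 <= K * n%:R) ->
    forall e, 0 < e -> exists N, forall n, (N <= n)%N ->
     `|\sum_(i < n) f i t * w i.+1 t| <= e * n%:R}.
Proof.
move=> Gf.
(* Dropping the terms at which the bound fails makes it hold for [xi K] on every path. *)
pose xi (K : nat) i t := if \sum_(j < i.+1) f j t ^+ 2 <= K.+1%:R * i.+1%:R then f i t else 0.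
have Gxi K : adapted G (xi K).
  move=> n; apply/measurable_funG; apply: measurable_fun_ifT => //.
    apply: measurable_fun_ler => //.
    apply: measurable_sum => j; apply: measurable_funX; apply: adapted_le => //.
    by rewrite -ltnS.
  exact: adapted_le.
have xiK K n t : \sum_(i < n) xi K i t ^+ 2 <= K.+1%:R * n%:R.
  have xif i : xi K i t ^+ 2 <= f i t ^+ 2.
    by rewrite /xi; case: ifP => // _; rewrite expr0n sqr_ge0.
  elim: n => [|n IHn]; first by rewrite big_ord0 mulr0.
  (* If the test passes at the last index, it bounds the whole sum; otherwise the last term of
     [xi K] is 0 and the induction hypothesis suffices. *)
  have [h|h] := boolP (\sum_(j < n.+1) f j t ^+ 2 <= K.+1%:R * n.+1%:R).
    by apply: le_trans h; apply: ler_sum => i _; exact: xif.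
  rewrite big_ord_recr/= {2}/xi (negbTE h) expr0n addr0.
  by apply: (le_trans IHn); rewrite ler_wpM2l// ler_nat.
have GNxi K : adapted G (fun i t => - xi K i t).
  by move=> n; apply/measurable_funG; apply: measurable_funN; exact: adapted_le.
have xiNK K n t : \sum_(i < n) (- xi K i t) ^+ 2 <= K.+1%:R * n%:R.
  by under eq_bigr do rewrite sqrrN; exact: xiK.
have e0 m : 0 < m.+1%:R^-1 :> R by rewrite invr_gt0.
have aeU K m := innovations_borel_cantelli (Gxi K) (ltr0Sn R K) (e0 m) (xiK K).
have aeL K m := innovations_borel_cantelli (GNxi K) (ltr0Sn R K) (e0 m) (xiNK K).
have := ae_foralln (fun K => ae_foralln (aeL K)).
have := ae_foralln (fun K => ae_foralln (aeU K)).
apply: filterS2 => t HU HL [K [N HK]] e egt0.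
(* Enlarging the constant absorbs the finite initial segment; at level [k] no term is then truncated
   on this path. *)
have [k kK] : exists k : nat, forall n, \sum_(i < n) f i t ^+ 2 <= k.+1%:R * n%:R.
  pose b := Num.max K (\sum_(i < N) f i t ^+ 2).
  have b0 : 0 <= b by rewrite le_max sumr_ge0 ?orbT// => i _; exact: sqr_ge0.
  exists (Num.bound b) => n.
  have bk : b <= (Num.bound b).+1%:R.
    by apply: le_trans (ltW (archi_boundP b0)) _; rewrite ler_nat.
  have [Nn|nN] := leqP N n.
    apply: le_trans (HK n Nn) _; rewrite ler_wpM2r//.
    by apply: le_trans bk; rewrite /b le_max lexx.
  case: n nN => [|n] nN; first by rewrite big_ord0 mulr0.
  apply: (@le_trans _ _ b).
    rewrite /b le_max; apply/orP; right.
    by apply: (ler_sum_nat_widen (F := fun i => f i t ^+ 2) (ltnW nN)) => i; exact: sqr_ge0.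
  by apply: le_trans bk _; rewrite ler_peMr// ler1n.
have xif i : xi k i t = f i t by rewrite /xi kK.
have [m me] : exists m : nat, m.+1%:R^-1 <= e.
  exists (Num.bound e^-1); rewrite -[leRHS]invrK lef_pV2 ?posrE ?invr_gt0//.
  have e1 : 0 <= e^-1 by rewrite invr_ge0 ltW.
  by apply: le_trans (ltW (archi_boundP e1)) _; rewrite ler_nat.
have [N1 H1] := HU k m; have [N2 H2] := HL k m.
exists (maxn N1 N2) => n; rewrite geq_max => /andP[/H1 nN1 /H2 nN2].
have men : m.+1%:R^-1 * n%:R <= e * n%:R by rewrite ler_wpM2r.
rewrite ler_norml; apply/andP; split.
  rewrite lerNl; apply: le_trans men; rewrite -sumrN; apply: le_trans nN2.
  by apply: ler_sum => i _; rewrite xif mulNr.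
apply: le_trans men; apply: le_trans nN1.
by apply: ler_sum => i _; rewrite xif.
Qed.
End innovations.

(** * Extreme eigenvalues of symmetric matrices *)

(** Row vectors, because [eigenvalue] refers to [v *m A]. *)
Definition quad_form (R : realType) n (A : 'M[R]_n) (x : 'rV[R]_n) : R := (x *m A *m x^T) 0 0.

Definition sqnorm (R : realType) n (x : 'rV[R]_n) : R := (x *m x^T) 0 0.

Lemma quad_formE (R : realType) n (A : 'M[R]_n) (x : 'rV[R]_n) :
  quad_form A x = \sum_j (\sum_i x 0 i * A i j) * x 0 j.
Proof. by rewrite /quad_form mxE; apply: eq_bigr => j _; rewrite !mxE. Qed.

Lemma sqnormE (R : realType) n (x : 'rV[R]_n) : sqnorm x = \sum_i x 0 i ^+ 2.
Proof. by rewrite /sqnorm mxE; apply: eq_bigr => i _; rewrite mxE expr2. Qed.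

Lemma sqnorm_ge0 (R : realType) n (x : 'rV[R]_n) : 0 <= sqnorm x.
Proof. by rewrite sqnormE sumr_ge0// => i _; rewrite sqr_ge0. Qed.

Lemma sqnorm_eq0 (R : realType) n (x : 'rV[R]_n) : (sqnorm x == 0) = (x == 0).
Proof.
rewrite sqnormE psumr_eq0; last by move=> i _; rewrite sqr_ge0.
apply/allP/eqP => [x0|-> i _]; last by rewrite /= mxE expr0n /= eqxx.
apply/rowP => i; rewrite mxE; apply/eqP; rewrite -sqrf_eq0.
by apply: x0; rewrite mem_index_enum.
Qed.

Lemma trmxZ (R : realType) n (a : R) (x : 'rV[R]_n) : (a *: x)^T = a *: x^T.
Proof. by apply/matrixP => i j; rewrite !mxE. Qed.

Lemma quad_formZ (R : realType) n (A : 'M[R]_n) (a : R) (x : 'rV[R]_n) :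
  quad_form A (a *: x) = a ^+ 2 * quad_form A x.
Proof.
by rewrite /quad_form trmxZ -scalemxAr -!scalemxAl scalerA mxE expr2.
Qed.

Lemma sqnormZ (R : realType) n (a : R) (x : 'rV[R]_n) : sqnorm (a *: x) = a ^+ 2 * sqnorm x.
Proof. by rewrite /sqnorm trmxZ -scalemxAr -!scalemxAl scalerA mxE expr2. Qed.

Lemma quad_form_continuous (R : realType) n (A : 'M[R]_n) :
  continuous (quad_form A : 'rV[R]_n -> R).
Proof.
have -> : quad_form A = fun x : 'rV[R]_n => \sum_j (\sum_i x 0 i * A i j) * x 0 j.
  by apply/funext => x; rewrite quad_formE.
have add : continuous (fun z : R * R => z.1 + z.2) by exact: (@add_continuous R^o).
have csum (F : 'I_n -> 'rV[R]_n -> R) : (forall j, continuous (F j)) ->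
    continuous (fun x => \sum_j F j x).
  by move=> cF; apply: (@continuous_big R 'I_n +%R 0 xpredT add _ _ F) => j _; exact: cF.
apply: (csum (fun j (x : 'rV[R]_n) => (\sum_i x 0 i * A i j) * x 0 j)) => j x.
apply: (@continuousM R _ (fun x : 'rV[R]_n => \sum_i x 0 i * A i j) (fun x => x 0 j)).
  apply: (csum (fun i (x : 'rV[R]_n) => x 0 i * A i j)) => i {}x.
  apply: (@continuousM R _ (fun x : 'rV[R]_n => x 0 i) (fun=> A i j)).
    exact: coord_continuous.
  exact: cst_continuous.
exact: coord_continuous.
Qed.

(** With [y = c *m B], the nonnegative polynomial [quad_form B (c + t *: y)] in [t] vanishes at 0,
    so its linear coefficient [2 * sqnorm y] is 0. *)
Lemma psd_kernel (R : realType) n (B : 'M[R]_n) (c : 'rV[R]_n) : B^T = B ->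
  (forall x, 0 <= quad_form B x) -> quad_form B c = 0 -> c *m B = 0.
Proof.
move=> Bsym B0 Bc.
apply/eqP; rewrite -sqnorm_eq0; apply/eqP.
set y := c *m B.
have ycross : (y *m B *m c^T) 0 0 = sqnorm y.
  rewrite -mulmxA -[B]Bsym -trmx_mul -/y.
  by [].
have qE t : quad_form B (c + t *: y) = 2 * t * sqnorm y + t ^+ 2 * quad_form B y.
  have trE : (c + t *: y)^T = c^T + t *: y^T by rewrite linearD /= trmxZ.
  rewrite /quad_form trE !mulmxDl !mulmxDr.
  rewrite -?scalemxAl -?scalemxAr -?scalemxAl.
  have addE (M N : 'M[R]_1) : (M + N) 0 0 = M 0 0 + N 0 0 by rewrite mxE.
  have scaleE (k : R) (M : 'M[R]_1) : (k *: M) 0 0 = k * M 0 0 by rewrite mxE.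
  rewrite !(addE, scaleE); move: Bc; rewrite /quad_form -/y => ->.
  by rewrite ycross -/(sqnorm y); ring.
have s0 := sqnorm_ge0 y; have g0 := B0 y.
(* A step along [- y] of this length makes the form negative unless [y = 0]. *)
have := B0 (c + - (sqnorm y / (quad_form B y + 1)) *: y); rewrite qE.
move: (sqnorm y) (quad_form B y) s0 g0 => s g s0 g0.
have g1 : 0 < g + 1 by rewrite ltr_wpDl.
have -> : 2 * - (s / (g + 1)) * s + (- (s / (g + 1))) ^+ 2 * g =
    - (s ^+ 2 * ((g + 2) / (g + 1) ^+ 2)).
  by field; rewrite gt_eqF.
rewrite oppr_ge0 pmulr_lle0 ?divr_gt0 ?exprn_gt0 ?ltr_wpDl// => s20.
by apply/eqP; rewrite -sqrf_eq0 eq_le s20 sqr_ge0.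
Qed.

(** If [c] maximizes the form on the unit sphere, with value [m], then [m%:M - A] is positive
    semidefinite and its form vanishes at [c]; by [psd_kernel], [c] is an eigenvector. Positive
    dimension makes the sphere nonempty. *)
Lemma symmetric_max_eigenvalue (R : realType) n (A : 'M[R]_n.+1) : A^T = A ->
  exists2 m, eigenvalue A m & forall x, quad_form A x <= m * sqnorm x.
Proof.
move=> Asym.
pose S := [set x : 'rV[R]_n.+1 | sqnorm x = 1].
have sqnorm1 x : sqnorm x = quad_form 1%:M x :> R by rewrite /quad_form mulmx1.
have S0 : S !=set0.
  exists (delta_mx 0 0); rewrite /S /= sqnormE (bigD1 ord0)//= !mxE eqxx expr1n.
  rewrite big1 ?addr0// => i /negbTE i0; rewrite !mxE i0.
  by rewrite expr0n.
have cS : compact S.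
  apply: bounded_closed_compact.
    (* The matrix norm is the largest entry in absolute value, at most the Euclidean norm 1. *)
    exists 1; split => // M M1 x Sx; rewrite /= {1}/Num.norm /= mx_normrE.
    apply: bigmax_le => [|[i j] _ /=]; first by rewrite (le_trans ler01) ?ltW.
    apply: le_trans (ltW M1); rewrite -(@ler_pXn2r _ 2) ?nnegrE// expr1n real_normK ?num_real//.
    have <- : sqnorm x = 1 by [].
    by rewrite sqnormE (ord1 i) (bigD1 j)//= lerDl sumr_ge0// => k _; rewrite sqr_ge0.
  rewrite (_ : S = sqnorm (n := n.+1) @^-1` [set 1])//.
  apply: preimage_closed => [x _|]; last exact: closed_eq.
  by rewrite (_ : sqnorm (n := n.+1) = quad_form 1%:M);
    [exact: quad_form_continuous|apply/funext].
have cA : {within S, continuous (quad_form A : 'rV[R]_n.+1 -> R)}.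
  exact/continuous_subspaceT/quad_form_continuous.
have [c /[!inE] Sc cmax] := compact_EVT_max S0 cS cA.
pose m := quad_form A c.
have mmax x : quad_form A x <= m * sqnorm x.
  have [->|x0] := eqVneq x 0.
    by rewrite -(scale0r 0) quad_formZ sqnormZ expr0n !mul0r mulr0.
  have sx : 0 < sqnorm x by rewrite lt_neqAle eq_sym sqnorm_eq0 x0 sqnorm_ge0.
  pose r := (Num.sqrt (sqnorm x))^-1.
  have r2 : r ^+ 2 = (sqnorm x)^-1 by rewrite exprVn sqr_sqrtr ?ltW.
  have := cmax (r *: x); rewrite inE /S /= sqnormZ r2 mulVf ?gt_eqF// => /(_ erefl).
  by rewrite quad_formZ r2 ler_pdivrMl// mulrC.
exists m => //.
pose B := m%:M - A.
have BE x : quad_form B x = m * sqnorm x - quad_form A x.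
  rewrite /B /quad_form mulmxBr mulmxBl mxE [in X in _ + X]mxE; congr (_ + _).
  by rewrite mul_mx_scalar -scalemxAl mxE.
have B0 x : 0 <= quad_form B x by rewrite BE subr_ge0.
have Bc : quad_form B c = 0 by rewrite BE Sc mulr1 subrr.
have Bsym : B^T = B by rewrite /B linearB /= tr_scalar_mx Asym.
have cB := psd_kernel Bsym B0 Bc.
apply/eigenvalueP; exists c.
  by apply/esym/eqP; rewrite -subr_eq0 -mul_mx_scalar -mulmxBr cB.
by rewrite -sqnorm_eq0 Sc oner_eq0.
Qed.

Lemma eigenvalue_le (R : realType) n (A : 'M[R]_n) (m a : R) :
  (forall x, quad_form A x <= m * sqnorm x) -> eigenvalue A a -> a <= m.
Proof.
move=> Am /eigenvalueP[v vA v0]; have := Am v.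
rewrite /quad_form vA -scalemxAl mxE -/(sqnorm v) ler_pM2r//.
by rewrite lt_neqAle eq_sym sqnorm_eq0 v0 sqnorm_ge0.
Qed.

Lemma quad_form_sup_eigenvalue (R : realType) n (A : 'M[R]_n) x : A^T = A ->
  quad_form A x <= sup [set a | eigenvalue A a] * sqnorm x.
Proof.
case: n A x => [|n] A x Asym.
  (* In dimension 0 both sides vanish, whatever value [sup] gives to the empty set. *)
  by rewrite quad_formE sqnormE !big_ord0 mulr0.
have [m Am mmax] := symmetric_max_eigenvalue Asym.
apply: le_trans (mmax x) _; rewrite ler_wpM2r ?sqnorm_ge0//.
apply: ub_le_sup => //; exists m => a Aa.
exact: eigenvalue_le Aa.
Qed.

(** The largest eigenvalue of [- A] is the opposite of an eigenvalue of [A]. *)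
Lemma quad_form_inf_eigenvalue (R : realType) n (A : 'M[R]_n) x : A^T = A ->
  inf [set a | eigenvalue A a] * sqnorm x <= quad_form A x.
Proof.
case: n A x => [|n] A x Asym.
  by rewrite quad_formE sqnormE !big_ord0 mulr0.
have oppE B a : eigenvalue (- B : 'M[R]_n.+1) (- a) = eigenvalue B a.
  apply/eigenvalueP/eigenvalueP => -[v vB v0]; exists v => //.
    by apply: oppr_inj; rewrite -mulmxN vB scaleNr.
  by rewrite mulmxN vB scaleNr.
have NAsym : (- A)^T = - A by rewrite linearN /= Asym.
have [m Am mmax] := symmetric_max_eigenvalue NAsym.
have {}Am : eigenvalue A (- m) by rewrite -oppE opprK.
have -> : quad_form A x = - quad_form (- A) x.
  by rewrite /quad_form mulmxN mulNmx [in RHS]mxE opprK.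
rewrite lerNr -mulNr; apply: le_trans (mmax x) _.
rewrite ler_wpM2r ?sqnorm_ge0// lerNr; apply: ge_inf => //.
exists (- m) => a; rewrite /= -oppE => /(eigenvalue_le mmax).
by rewrite lerNl.
Qed.

(** * Regularized least squares *)

(** Coordinates range over all of [nat] and the order [q] is absent, so estimates of different
    orders are compared without casts between dimensions. *)
Definition regressor (R : realType) (s u : nat -> R) p i k : R :=
  if (k < p)%N then reg s i k else reg u i (k - p).

Definition linpred (R : realType) (s u : nat -> R) p m (z : nat -> R) i : R :=
  \sum_(k < m) z k * regressor s u p i k.

Lemma psiE (R : realType) (s u : nat -> R) p q i k j :
  psi s u p q i k j = regressor s u p i k.
Proof.
rewrite /regressor mxE; case: splitP => [l ->|l ->]; first by rewrite mxE.
by rewrite mxE addKn.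
Qed.

Lemma row_mul_psi (R : realType) (s u : nat -> R) p q i (x : 'rV[R]_(p + q)) (z : nat -> R) :
  (forall k, x 0 k = z k) -> (x *m psi s u p q i) 0 0 = linpred s u p (p + q) z i.
Proof. by move=> xz; rewrite mxE; apply: eq_bigr => k _; rewrite psiE xz. Qed.

Lemma cv_getE (R : realType) m (x : 'cV[R]_m) (k : 'I_m) : cv_get x k = x k 0.
Proof. by rewrite /cv_get valK. Qed.

(** The default value 0 is the zero padding of the shorter estimates. *)
Lemma cv_get_out (R : realType) m (x : 'cV[R]_m) k : (m <= k)%N -> cv_get x k = 0.
Proof. by move=> mk; rewrite /cv_get; case: insubP => // i; rewrite ltnNge mk. Qed.

Lemma Pinv_sym (R : realType) (s u : nat -> R) p q n : (Pinv s u p q n)^T = Pinv s u p q n.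
Proof.
rewrite /Pinv linearD /= trmx1 linear_sum /=; congr (_ + _).
by apply: eq_bigr => i _; rewrite trmx_mul trmxK.
Qed.

Lemma bilinear_Pinv (R : realType) (s u : nat -> R) p q n (x y : 'rV[R]_(p + q)) :
  (x *m Pinv s u p q n *m y^T) 0 0 = (x *m y^T) 0 0 +
  \sum_(i < n) (x *m psi s u p q i) 0 0 * (y *m psi s u p q i) 0 0.
Proof.
rewrite /Pinv mulmxDr mulmx1 mulmxDl mxE; congr (_ + _).
rewrite mulmx_sumr mulmx_suml summxE; apply: eq_bigr => i _.
rewrite mulmxA -mulmxA -trmx_mul [LHS]mxE big_ord1; congr (_ * _).
by rewrite mxE.
Qed.

Lemma quad_form_Pinv (R : realType) (s u : nat -> R) p q n (z : nat -> R) :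
  quad_form (Pinv s u p q n) (\row_k z k) =
  \sum_(k < p + q) z k ^+ 2 + \sum_(i < n) linpred s u p (p + q) z i ^+ 2.
Proof.
rewrite /quad_form bilinear_Pinv -/(sqnorm _) sqnormE.
congr (_ + _); first by apply: eq_bigr => k _; rewrite mxE.
by apply: eq_bigr => i _; rewrite !(@row_mul_psi _ _ _ _ _ _ _ z) // => k; rewrite mxE.
Qed.

(** The identity term makes the form definite: for a kernel row [x], [sqnorm x] plus a sum of
    squares is 0. *)
Lemma Pinv_unit (R : realType) (s u : nat -> R) p q n : Pinv s u p q n \in unitmx.
Proof.
rewrite -row_free_unit -kermx_eq0; apply/eqP/row_matrixP => i.
rewrite row0; set x := row i _; apply/eqP; rewrite -sqnorm_eq0 eq_le sqnorm_ge0 andbT.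
have xP : x *m Pinv s u p q n = 0.
  by apply/eqP; rewrite -sub_kermx row_sub.
have := bilinear_Pinv s u n x x.
rewrite xP mul0mx mxE -/(sqnorm x) => /eqP; rewrite eq_sym addrC addr_eq0 => /eqP E.
by rewrite -oppr_ge0 -E sumr_ge0// => j _; rewrite -expr2 sqr_ge0.
Qed.

(** [lambda_min] at [n] belongs to the matrix built from [n.+1] regressors, hence the range of the
    sum; the term without regressors comes from the identity in [Pinv]. *)
Lemma lambda_min_le (R : realType) (s u : nat -> R) p q n (z : nat -> R) :
  lambda_min s u p q n * \sum_(k < p + q) z k ^+ 2 <=
  \sum_(k < p + q) z k ^+ 2 + \sum_(i < n.+1) linpred s u p (p + q) z i ^+ 2.
Proof.
have := quad_form_inf_eigenvalue (\row_k z k) (Pinv_sym s u p q n.+1).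
rewrite quad_form_Pinv sqnormE.
by under eq_bigr do rewrite mxE.
Qed.

Lemma le_lambda_max (R : realType) (s u : nat -> R) p q n (z : nat -> R) :
  \sum_(k < p + q) z k ^+ 2 + \sum_(i < n.+1) linpred s u p (p + q) z i ^+ 2 <=
  lambda_max s u p q n * \sum_(k < p + q) z k ^+ 2.
Proof.
have := quad_form_sup_eigenvalue (\row_k z k) (Pinv_sym s u p q n.+1).
rewrite quad_form_Pinv sqnormE.
by under [X in _ * X]eq_bigr do rewrite mxE.
Qed.

Lemma sigmaE (R : realType) (s u : nat -> R) p q n :
  sigma s u p q n =
  \sum_(i < n) (s i.+1 - linpred s u p (p + q) (cv_get (theta s u p q n)) i) ^+ 2.
Proof.
apply: eq_bigr => i _; rewrite (@row_mul_psi _ _ _ _ _ _ _ (cv_get (theta s u p q n)))//.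
by move=> k; rewrite mxE cv_getE.
Qed.

(** Since [Pinv] contains the identity, [theta] minimizes the ridge criterion, residual sum plus
    squared norm; the norm of the minimizer is dropped on the left. *)
Lemma sigma_le (R : realType) (s u : nat -> R) p q n (z : nat -> R) :
  sigma s u p q n <= \sum_(i < n) (s i.+1 - linpred s u p (p + q) z i) ^+ 2 +
    \sum_(k < p + q) z k ^+ 2.
Proof.
pose th := (theta s u p q n)^T; pose x : 'rV[R]_(p + q) := \row_k z k; pose y := x - th.
pose l (x : 'rV[R]_(p + q)) i := (x *m psi s u p q i) 0 0.
(* The normal equations, tested against [y]. *)
have normal : \sum_(i < n) s i.+1 * l y i = (y *m th^T) 0 0 + \sum_(i < n) l y i * l th i.
  rewrite -bilinear_Pinv /th trmxK /theta -mulmxA mulKVmx ?Pinv_unit//.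
  rewrite mulmx_sumr summxE; apply: eq_bigr => i _.
  by rewrite -scalemxAr mxE.
have lD i : linpred s u p (p + q) z i = l th i + l y i.
  rewrite -(@row_mul_psi _ _ _ _ _ _ x)//; last by move=> k; rewrite mxE.
  transitivity ((th *m psi s u p q i + y *m psi s u p q i) 0 0); last by rewrite mxE.
  by rewrite -mulmxDl /y addrC subrK.
have normD : \sum_(k < p + q) z k ^+ 2 = sqnorm th + 2 * (y *m th^T) 0 0 + sqnorm y.
  have -> : \sum_(k < p + q) z k ^+ 2 = sqnorm x.
    by rewrite sqnormE; apply: eq_bigr => k _; rewrite mxE.
  rewrite !sqnormE mxE mulr_sumr -!big_split /=; apply: eq_bigr => k _.
  by rewrite /y !mxE; ring.
rewrite normD /sigma; under [X in _ <= X + _]eq_bigr do rewrite lD.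
rewrite -/th.
have -> : \sum_(i < n) (s i.+1 - (l th i + l y i)) ^+ 2 =
    \sum_(i < n) (s i.+1 - l th i) ^+ 2 - 2 * (\sum_(i < n) s i.+1 * l y i) +
    2 * (\sum_(i < n) l y i * l th i) + \sum_(i < n) l y i ^+ 2.
  rewrite !mulr_sumr -sumrN -!big_split /=; apply: eq_bigr => i _; ring.
(* The two occurrences of [y *m th^T] cancel, leaving as excess the squared norms of [th] and [y]
   and the sum of [l y i ^+ 2]. *)
rewrite normal -/(l th _).
have y2 : 0 <= \sum_(i < n) l y i ^+ 2 by rewrite sumr_ge0// => i _; rewrite sqr_ge0.
have := sqnorm_ge0 th; have := sqnorm_ge0 y.
set A := \sum_(i < n) (s i.+1 - l th i) ^+ 2; rewrite -/A.
lra.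
Qed.

(** * Consistency along a path *)

Definition noise_sum (R : realType) (s u w : nat -> R) p k n : R :=
  \sum_(i < n) regressor s u p i k * w i.+1.

Lemma linpredB (R : realType) (s u : nat -> R) p m (z z' : nat -> R) i :
  linpred s u p m (fun k => z k - z' k) i = linpred s u p m z i - linpred s u p m z' i.
Proof. by rewrite -sumrB; apply: eq_bigr => k _; rewrite mulrBl. Qed.

Lemma sum_widen_zero (R : realType) (F : nat -> R) m m' : (m <= m')%N ->
  (forall k, (m <= k)%N -> F k = 0) -> \sum_(k < m') F k = \sum_(k < m) F k.
Proof.
move=> mm' F0; rewrite -(subnKC mm') big_split_ord/= [X in _ + X]big1 ?addr0// => k _.
by rewrite F0// leq_addr.
Qed.

Lemma linpred_widen (R : realType) (s u : nat -> R) p m m' (z : nat -> R) i : (m <= m')%N ->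
  (forall k, (m <= k)%N -> z k = 0) -> linpred s u p m' z i = linpred s u p m z i.
Proof.
move=> mm' z0; apply: (sum_widen_zero (F := fun k => z k * regressor s u p i k) mm') => k mk.
by rewrite z0// mul0r.
Qed.

(** [z] may depend on the whole sample, so only the coordinates are tested against the noise. From
    [2 |z k| <= 1 + z k ^ 2] comes a quadratic bound that the smallest eigenvalue can absorb. *)
Lemma linpred_noise_le (R : realType) (s u w z : nat -> R) p m n (E : R) :
  (forall k, (k < m)%N -> `|noise_sum s u w p k n| <= E) ->
  `|2 * \sum_(i < n) linpred s u p m z i * w i.+1| <= E * (m%:R + \sum_(k < m) z k ^+ 2).
Proof.
move=> HE.
have -> : \sum_(i < n) linpred s u p m z i * w i.+1 =
    \sum_(k < m) z k * noise_sum s u w p k n.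
  under eq_bigr do rewrite mulr_suml.
  rewrite exchange_big; apply: eq_bigr => k _; rewrite mulr_sumr.
  by apply: eq_bigr => i _; rewrite mulrA.
rewrite mulr_sumr; apply: le_trans (ler_norm_sum _ _ _) _.
have -> : m%:R + \sum_(k < m) z k ^+ 2 = \sum_(k < m) (1 + z k ^+ 2).
  by rewrite big_split /= sumr_const card_ord.
rewrite mulr_sumr; apply: ler_sum => k _.
have E0 := le_trans (normr_ge0 _) (HE k (ltn_ord k)).
rewrite !normrM (ger0_norm (ler0n _ 2)) mulrA mulrC.
apply: ler_pM => //; first exact: HE.
have := sqr_ge0 (1 - `|z k|); rewrite -[z k ^+ 2]real_normK ?num_real//; nra.
Qed.

(** The bound [- 2 eta x >= - 2 eta^2 - x^2 / 2] costs [2 h N] and leaves half the energy of [x], at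
    least [(c2 N - 1) D / 2]. This pays for the noise term [e N D] once [e <= c2 / 4] and
    [c2 N >= 2]. *)
Lemma overfit_sigma_ge (R : realType) (s u w eta z0 : nat -> R) p q n (c2 h e : R) :
  (forall i, s i.+1 = linpred s u p (p + q) z0 i + w i.+1 + eta i) ->
  \sum_(i < n.+1) eta i ^+ 2 <= h * n.+1%:R ->
  (forall k, (k < p + q)%N -> `|noise_sum s u w p k n.+1| <= e * n.+1%:R) ->
  c2 * n.+1%:R <= lambda_min s u p q n ->
  e <= c2 / 4 -> 2 <= c2 * n.+1%:R ->
  \sum_(i < n.+1) (w i.+1 + eta i) ^+ 2 - 2 * h * n.+1%:R - e * n.+1%:R * (p + q)%:R
    <= sigma s u p q n.+1.
Proof.
move=> sE Heta HM Hlam ec c2n; set N : R := n.+1%:R in Heta HM Hlam c2n *.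
pose d k := cv_get (theta s u p q n.+1) k - z0 k.
pose x i := linpred s u p (p + q) d i.
have -> : sigma s u p q n.+1 = \sum_(i < n.+1) (w i.+1 + eta i - x i) ^+ 2.
  rewrite sigmaE; apply: eq_bigr => i _; congr (_ ^+ 2).
  by rewrite /x linpredB sE; ring.
have /ler_normlP[_ cross] := linpred_noise_le d HM.
have Q := lambda_min_le s u p q n d.
rewrite -/(x _) in Q.
set D := \sum_(k < p + q) d k ^+ 2 in cross Q.
have D0 : 0 <= D by rewrite sumr_ge0// => k _; exact: sqr_ge0.
have step : \sum_(i < n.+1) (w i.+1 + eta i) ^+ 2 - 2 * \sum_(i < n.+1) x i * w i.+1
    - 2 * \sum_(i < n.+1) eta i ^+ 2 + 2^-1 * \sum_(i < n.+1) x i ^+ 2 <=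
    \sum_(i < n.+1) (w i.+1 + eta i - x i) ^+ 2.
  rewrite !mulr_sumr -!sumrN -!big_split /=; apply: ler_sum => i _.
  have := sqr_ge0 (eta i - x i / 2); nra.
apply: le_trans step.
have Q' : c2 * N * D <= D + \sum_(i < n.+1) x i ^+ 2.
  by apply: le_trans Q; rewrite ler_wpM2r.
rewrite -/(x _) in cross.
have N0 : 0 <= N by exact: ler0n.
have eD : e * N * D <= c2 / 4 * N * D by rewrite !ler_wpM2r.
have c2D : 2 * D <= c2 * N * D by rewrite ler_wpM2r.
move: cross Q' Heta eD c2D; rewrite /x; lra.
Qed.

(** The omitted coefficient forces [D >= b^2], and the smallest eigenvalue turns this into energy of
    [x], kept in full as a gain. The largest eigenvalue and [gam] bound the same energy above, which
    limits the correlation of [x] with [eta]. *)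
Lemma underfit_sigma_ge (R : realType) (s u w eta z0 : nat -> R) p q q0 n
    (c2 c4 h e gam b : R) :
  (q < q0)%N -> 0 < h -> 0 < c4 ->
  (forall i, s i.+1 = linpred s u p (p + q0) z0 i + w i.+1 + eta i) ->
  \sum_(i < n.+1) eta i ^+ 2 <= h * n.+1%:R ->
  (forall k, (k < p + q0)%N -> `|noise_sum s u w p k n.+1| <= e * n.+1%:R) ->
  c2 * n.+1%:R <= lambda_min s u p q0 n ->
  lambda_max s u p q0 n <= c4 * n.+1%:R ->
  Num.sqrt (\sum_(k < p + q0) (z0 k - cv_get (theta s u p q n.+1) k) ^+ 2) <= gam ->
  z0 (p + q0).-1 = b -> b != 0 -> 0 <= e -> 1 <= c2 * n.+1%:R ->
  \sum_(i < n.+1) (w i.+1 + eta i) ^+ 2 - e * n.+1%:R * ((p + q0)%:R + gam ^+ 2)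
    - 2 * gam * Num.sqrt (c4 * h) * n.+1%:R + (c2 * n.+1%:R - 1) * b ^+ 2
    <= sigma s u p q n.+1.
Proof.
move=> qq0 h0 c40 sE Heta HM Hmin Hmax Hgam zb b0 e0 c2n.
set N : R := n.+1%:R in Heta HM Hmin Hmax c2n *.
pose th := cv_get (theta s u p q n.+1).
pose d k := z0 k - th k.
pose x i := linpred s u p (p + q0) d i.
have -> : sigma s u p q n.+1 = \sum_(i < n.+1) (w i.+1 + eta i + x i) ^+ 2.
  rewrite sigmaE; apply: eq_bigr => i _; congr (_ ^+ 2).
  have <- : linpred s u p (p + q0) th i = linpred s u p (p + q) th i.
    apply: linpred_widen; first by rewrite leq_add2l ltnW.
    by move=> k qk; exact: cv_get_out.
  by rewrite /x linpredB sE; ring.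
have /ler_normlP[cross _] := linpred_noise_le d HM.
have Qmin := lambda_min_le s u p q0 n d.
have Qmax := le_lambda_max s u p q0 n d.
rewrite -/(x _) in Qmin Qmax cross.
set D := \sum_(k < p + q0) d k ^+ 2 in cross Qmin Qmax Hgam.
have D0 : 0 <= D by rewrite sumr_ge0// => k _; exact: sqr_ge0.
have gam0 : 0 <= gam by apply: le_trans Hgam; exact: sqrtr_ge0.
have Dgam : D <= gam ^+ 2.
  by rewrite -[D]sqr_sqrtr// ler_pXn2r ?nnegrE ?sqrtr_ge0.
(* At the last coordinate the padded estimate is 0, so the error there is exactly [b]. *)
have bD : b ^+ 2 <= D.
  have pq : ((p + q0).-1 < p + q0)%N by rewrite prednK// addn_gt0 (leq_ltn_trans _ qq0) ?orbT.
  rewrite /D (bigD1 (Ordinal pq)) //= {1}/d zb /th cv_get_out; last first.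
    by rewrite -ltnS prednK ?addn_gt0 ?(leq_ltn_trans _ qq0) ?orbT// ltn_add2l.
  by rewrite subr0 lerDl sumr_ge0// => k _; exact: sqr_ge0.
(* Needed for [tau] below to be positive. *)
have gamp : 0 < gam.
  rewrite lt_neqAle gam0 andbT eq_sym; apply/eqP => g0.
  by have := le_trans bD Dgam; rewrite g0 expr0n leNgt exprn_even_gt0//= b0.
set S := Num.sqrt (c4 * h).
have S0 : 0 < S by rewrite sqrtr_gt0 mulr_gt0.
have S2 : S ^+ 2 = c4 * h by rewrite sqr_sqrtr// ltW// mulr_gt0.
(* AM-GM: [2 eta x >= - tau eta^2 - x^2 / tau] with [tau = gam S / h] balances the two sums *)
pose tau := gam * S / h.
have tau0 : 0 < tau by rewrite divr_gt0// mulr_gt0.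
have step : \sum_(i < n.+1) (w i.+1 + eta i) ^+ 2 + 2 * \sum_(i < n.+1) x i * w i.+1
    - tau * \sum_(i < n.+1) eta i ^+ 2 - tau^-1 * \sum_(i < n.+1) x i ^+ 2
    + \sum_(i < n.+1) x i ^+ 2 <=
    \sum_(i < n.+1) (w i.+1 + eta i + x i) ^+ 2.
  rewrite !mulr_sumr -!sumrN -!big_split /=; apply: ler_sum => i _.
  have : 0 <= tau * (eta i + tau^-1 * x i) ^+ 2 by rewrite mulr_ge0 ?sqr_ge0// ltW.
  have -> : tau * (eta i + tau^-1 * x i) ^+ 2 =
      tau * eta i ^+ 2 + 2 * eta i * x i + tau^-1 * x i ^+ 2.
    by field; rewrite gt_eqF.
  lra.
apply: le_trans step.
have N0 : 0 <= N by exact: ler0n.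
(* The loss of 1 comes from the identity term of [Pinv]. *)
have Q1 : (c2 * N - 1) * b ^+ 2 <= \sum_(i < n.+1) x i ^+ 2.
  apply: (@le_trans _ _ ((c2 * N - 1) * D)); first by rewrite ler_wpM2l// subr_ge0.
  rewrite mulrBl mul1r lerBlDl; apply: le_trans Qmin.
  by rewrite ler_wpM2r.
have Q2 : tau^-1 * \sum_(i < n.+1) x i ^+ 2 <= gam * S * N.
  have -> : gam * S * N = tau^-1 * (c4 * N * gam ^+ 2).
    rewrite /tau; have -> : c4 = S ^+ 2 / h by rewrite S2 mulfK ?gt_eqF.
    by field; rewrite !gt_eqF.
  rewrite ler_pM2l ?invr_gt0//.
  apply: (@le_trans _ _ (c4 * N * D)); last by rewrite ler_wpM2l// mulr_ge0// ltW.
  apply: (@le_trans _ _ (lambda_max s u p q0 n * D)); last by rewrite ler_wpM2r.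
  by apply: le_trans Qmax; rewrite lerDr.
have E1 : tau * \sum_(i < n.+1) eta i ^+ 2 <= gam * S * N.
  have -> : gam * S * N = tau * (h * N) by rewrite /tau; field; rewrite gt_eqF.
  by rewrite ler_pM2l.
have E2 : e * N * ((p + q0)%:R + D) <= e * N * ((p + q0)%:R + gam ^+ 2).
  by rewrite ler_wpM2l ?lerD2l// mulr_ge0.
move: cross; rewrite /x in Q1 Q2 *; lra.
Qed.

Lemma eventually_forall_lt m (Q : nat -> nat -> Prop) :
  (forall k, (k < m)%N -> exists N, forall n, (N <= n)%N -> Q k n) ->
  exists N, forall n, (N <= n)%N -> forall k, (k < m)%N -> Q k n.
Proof.
elim: m => [|m IHm] H; first by exists 0%N.
have [N1 H1] := IHm (fun k km => H k (leqW km)).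
have [N2 H2] := H m (ltnSn m).
exists (maxn N1 N2) => n; rewrite geq_max => /andP[n1 n2] k.
by rewrite ltnS leq_eqVlt => /predU1P[->|]; [exact: H2|exact: H1].
Qed.

Lemma eventually_ge (R : realType) (a x : R) : 0 < a ->
  exists N, forall n, (N <= n)%N -> x <= a * n%:R.
Proof.
move=> a0; exists (Num.bound `|x / a|) => n Nn.
rewrite mulrC -ler_pdivrMr//; apply: le_trans (ler_norm _) _.
by apply: le_trans (ltW (archi_boundP (normr_ge0 _))) _; rewrite ler_nat.
Qed.

(** The budget for [N] samples: [2 h N] covers the constants [Z + b^2] and [h N] the noise
    fluctuations, which accounts for the [3 h] of the upper bound on [v]. Overfitting costs a
    further [2 h N], whence [5 h] in the lower bound. *)
Lemma order_consistency (R : realType) (s u w eta z0 v : nat -> R) p q0 qstar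
    (c2 c4 h gam b beta1 beta2 : R) :
  (0 < q0 <= qstar)%N -> 0 < c2 -> 0 < c4 -> 0 < h -> 0 < beta1 -> 0 < beta2 < 1 ->
  (forall k, (p + q0 <= k)%N -> z0 k = 0) -> z0 (p + q0).-1 = b -> b != 0 ->
  (forall i, s i.+1 = linpred s u p (p + q0) z0 i + w i.+1 + eta i) ->
  (exists N, forall n, (N <= n)%N -> \sum_(i < n) eta i ^+ 2 <= h * n%:R) ->
  (forall k, (k < p + qstar)%N -> forall e, 0 < e ->
     exists N, forall n, (N <= n)%N -> `|noise_sum s u w p k n| <= e * n%:R) ->
  (forall q, (q <= qstar)%N -> exists N, forall n, (N <= n)%N ->
     c2 * n.+1%:R <= lambda_min s u p q n) ->
  (exists N, forall n, (N <= n)%N -> lambda_max s u p q0 n <= c4 * n.+1%:R) ->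
  (exists N, forall n, (N <= n)%N -> forall q, (q <= q0)%N ->
     Num.sqrt (\sum_(k < p + q0) (z0 k - cv_get (theta s u p q n) k) ^+ 2) <= gam) ->
  (forall n, (5 * h + beta1) * n%:R <= v n /\
     v n <= beta2 / qstar%:R *
       (b ^+ 2 * c2 - 2 * gam * Num.sqrt (c4 * h) - 3 * h) * n%:R) ->
  exists N, forall n, (N <= n)%N -> forall q, (q <= qstar)%N ->
     (forall q', (q' <= qstar)%N ->
        sigma s u p q n + v n * (p + q)%:R <= sigma s u p q' n + v n * (p + q')%:R) ->
     q = q0.
Proof.
move=> /andP[q00 q0s] c20 c40 h0 beta10 /andP[beta20 beta21] z00 zb b0 sE
  [Neta Heta] HM HL [Nmax Hmax] [Ngam Hgam] Hv.
set L := b ^+ 2 * c2 - 2 * gam * Num.sqrt (c4 * h) - 3 * h in Hv.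
have qs0 : 0 < qstar%:R :> R by rewrite ltr0n (leq_trans q00).
(* The bounds on [v 1] are compatible only if [L] is positive. *)
have L0 : 0 <= L.
  have [] := Hv 1%N; rewrite !mulr1 => h1 h2.
  have : 0 < beta2 / qstar%:R * L by apply: lt_le_trans h2; apply: lt_le_trans h1; lra.
  by rewrite pmulr_rgt0 ?divr_gt0// => /ltW.
(* [C] dominates both noise factors, [(p + q)%:R] and [(p + q0)%:R + gam ^+ 2], so [e <= h / C]
   keeps either error below [h N]. *)
pose C := (p + qstar)%:R + gam ^+ 2 + 1.
have C0 : 0 < C by rewrite ltr_wpDl// addr_ge0// sqr_ge0.
pose e := Num.min (c2 / 4) (h / C).
have e0 : 0 < e by rewrite lt_min !divr_gt0.
have ec2 : e <= c2 / 4 by rewrite ge_min lexx.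
have eC : e * C <= h by rewrite -ler_pdivlMr// ge_min lexx orbT.
have [NM {}HM] := eventually_forall_lt (fun k kp => HM k kp e e0).
have [NL {}HL] := eventually_forall_lt (m := qstar.+1) HL.
pose Z := \sum_(k < p + q0) z0 k ^+ 2.
have h20 : 0 < 2 * h by rewrite mulr_gt0.
have [Nh Hh] := eventually_ge (Z + b ^+ 2 + 1) h20.
have [Nc Hc] := eventually_ge 2 c20.
(* Eigenvalue bounds at [n] serve the sample size [n.+1], hence the shifted thresholds. *)
pose N0 := maxn Neta (maxn Nmax.+1 (maxn Ngam (maxn NM (maxn NL.+1 (maxn Nh Nc))))).
exists N0 => -[|n]; rewrite !geq_max ?ltn0 ?andbF//.
move=> /and5P[/Heta{}Heta /Hmax{}Hmax /Hgam{}Hgam /HM{}HM /and3P[/HL{}HL /Hh{}Hh /Hc{}Hc]].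
have [v1 v2] := Hv n.+1.
move=> q qs Hq; have {}Hq := Hq q0 q0s.
(* The true parameter competes in the ridge criterion. *)
have sq0 : sigma s u p q0 n.+1 <= \sum_(i < n.+1) (w i.+1 + eta i) ^+ 2 + Z.
  have := sigma_le s u p q0 n.+1 z0; congr (_ <= _ + _).
  by apply: eq_bigr => i _; rewrite sE; congr (_ ^+ 2); ring.
have N1 : 1 <= n.+1%:R :> R by rewrite ler1n.
set N : R := n.+1%:R in Heta Hmax HM HL Hh Hc v1 v2 N1.
have b2 : 0 < b ^+ 2 by rewrite exprn_even_gt0.
have hN : 0 < h * N by rewrite mulr_gt0// (lt_le_trans ltr01).
have betaN : 0 <= beta1 * N by rewrite mulr_ge0// ltW// (lt_le_trans ltr01).
have Nge0 : 0 <= N by exact: ler0n.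
have v0 : 0 <= v n.+1 by apply: le_trans v1; rewrite mulr_ge0//; lra.
case: (ltngtP q q0) => // [qq0|q0q]; exfalso.
  have HMq0 k : (k < p + q0)%N -> `|noise_sum s u w p k n.+1| <= e * n.+1%:R.
    by move=> kp; apply: HM; rewrite (leq_trans kp)// leq_add2l.
  have := underfit_sigma_ge qq0 h0 c40 sE Heta HMq0 (HL q0 q0s) Hmax (Hgam q (ltnW qq0))
    zb b0 (ltW e0) (le_trans (ler1n _ 2) Hc).
  rewrite -/N => ge.
  have eN : e * N * ((p + q0)%:R + gam ^+ 2) <= h * N.
    rewrite mulrAC ler_wpM2r//; apply: le_trans eC; rewrite (ler_wpM2l (ltW e0))//.
    by rewrite /C -addrA lerD ?ler_nat ?leq_add2l// lerDl.
  (* At most [qstar] penalties are saved, which the factor [1 / qstar] in the bound on [v]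
     offsets. *)
  have vq : v n.+1 * (q0%:R - q%:R) <= L * N.
    apply: (@le_trans _ _ (v n.+1 * qstar%:R)).
      by rewrite ler_wpM2l// lerBlDr (@le_trans _ _ qstar%:R) ?ler_nat// lerDl.
    rewrite -ler_pdivlMr//; apply: le_trans v2 _.
    have -> : beta2 / qstar%:R * L * N = beta2 * (L * N / qstar%:R) by ring.
    by rewrite ler_piMl ?(ltW beta21)// divr_ge0// mulr_ge0.
  move: Hq; rewrite !natrD.
  rewrite /L in vq; lra.
have qs1 : q0%:R + 1 <= q%:R :> R by rewrite natr1 ler_nat.
have HMq k : (k < p + q)%N -> `|noise_sum s u w p k n.+1| <= e * n.+1%:R.
  by move=> kp; apply: HM; rewrite (leq_trans kp)// leq_add2l.
have sE' i : s i.+1 = linpred s u p (p + q) z0 i + w i.+1 + eta i.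
  by rewrite (@linpred_widen _ _ _ _ (p + q0)%N)// leq_add2l ltnW.
have := overfit_sigma_ge sE' Heta HMq (HL q qs) ec2 Hc.
rewrite -/N => ge.
have eN : e * N * (p + q)%:R <= h * N.
  rewrite mulrAC ler_wpM2r//; apply: le_trans eC; rewrite (ler_wpM2l (ltW e0))//.
  rewrite /C -addrA (@le_trans _ _ (p + qstar)%:R) ?ler_nat ?leq_add2l//.
  by rewrite lerDl addr_ge0// sqr_ge0.
have vq : v n.+1 <= v n.+1 * (q%:R - q0%:R) by rewrite ler_peMr//; lra.
move: Hq; rewrite !natrD; lra.
Qed.

(** * Quantized ARX systems *)

Lemma quantize_error (R : realType) (eps y : R) : 0 < eps -> `|quantize eps y - y| <= eps / 2.
Proof.
move=> e0; rewrite /quantize; set x := y / eps + 2^-1.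
have -> : y = eps * (x - 2^-1) by rewrite /x addrK mulrC divfK ?gt_eqF.
have /andP[] := floor_itv x; rewrite intrD.
move: (Num.floor x)%:~R => f fx xf.
rewrite -mulrBr normrM (gtr0_norm e0) ler_pM2l// ler_norml.
by apply/andP; split; lra.
Qed.

Lemma measurable_quantize (R : realType) (eps : R) : 0 < eps ->
  measurable_fun setT (quantize eps).
Proof.
move=> e0; apply: nondecreasing_measurable => // x y xy.
rewrite /quantize ler_pM2l// ler_int; apply: le_floor.
by rewrite lerD2r ler_pM2r ?invr_gt0.
Qed.

(** The linear gap [(h - c) n] swallows the first [m] terms. *)
Lemma eventually_sum_le (R : realType) (F : nat -> R) m (c h : R) :
  (forall i, 0 <= F i) -> (forall i, (m <= i)%N -> F i <= c) -> 0 <= c -> c < h ->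
  exists N, forall n, (N <= n)%N -> \sum_(i < n) F i <= h * n%:R.
Proof.
move=> F0 Fc c0 ch.
have ub n : \sum_(i < n) F i <= \sum_(i < m) F i + c * n%:R.
  elim: n => [|n IHn]; first by rewrite big_ord0 mulr0 addr0 sumr_ge0.
  have [mn|nm] := leqP m n.
    by rewrite big_ord_recr/= -natr1 mulrDr mulr1 addrA lerD// Fc.
  rewrite (@le_trans _ _ (\sum_(i < m) F i)) ?lerDl ?mulr_ge0//.
  exact: ler_sum_nat_widen.
have hc : 0 < h - c by rewrite subr_gt0.
have [N HN] := eventually_ge (\sum_(i < m) F i) hc.
exists N => n /HN Hn; apply: le_trans (ub n) _.
by rewrite -lerBrDr -mulrBl.
Qed.

(** Lag [k] is lag 0 delayed, so it sums the same squares over a shorter window. *)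
Lemma sum_reg_le (R : realType) (f : nat -> R) k n :
  \sum_(i < n) reg f i k ^+ 2 <= \sum_(i < n) reg f i 0 ^+ 2.
Proof.
have regE i : reg f i k = reg f (i - k) 0.
  by rewrite /reg subn_gt0 subn0.
have [nk|kn] := leqP n k.
  rewrite big1 ?sumr_ge0// => [i _|i _]; first exact: sqr_ge0.
  by rewrite /reg ltnNge (leq_trans (ltnW (ltn_ord i)) nk) expr0n.
rewrite -(subnKC (ltnW kn)) big_split_ord/= big1 ?add0r => [|i _]; last first.
  by rewrite /reg ltnNge (ltnW (ltn_ord i)) expr0n.
rewrite (eq_bigr (fun i : 'I_(n - k) => reg f i 0 ^+ 2)) => [|i _]; last first.
  by rewrite regE addKn.
apply: (ler_sum_nat_widen (F := fun i => reg f i 0 ^+ 2)); first exact: leq_addl.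
by move=> i; exact: sqr_ge0.
Qed.

(** Unit vectors in [le_lambda_max] reach only coordinates below [p + q]. Every lag is dominated by
    lag 0 of the same signal, at coordinate [0] or [p], so the bound for one order serves all
    [k]. *)
Lemma sum_regressor_le (R : realType) (s u : nat -> R) p q k (c : R) :
  (0 < p)%N -> (0 < q)%N ->
  (exists N, forall n, (N <= n)%N -> lambda_max s u p q n <= c * n.+1%:R) ->
  exists K N, forall n, (N <= n)%N -> \sum_(i < n) regressor s u p i k ^+ 2 <= K * n%:R.
Proof.
move=> p0 q0 [N HN]; exists c, N.+1 => -[//|n]; rewrite ltnS => /HN Hn.
have diag l : (l < p + q)%N -> \sum_(i < n.+1) regressor s u p i l ^+ 2 <= c * n.+1%:R.
  move=> lpq; apply: le_trans Hn.
  have := le_lambda_max s u p q n (fun k => (k == l)%:R).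
  have -> : \sum_(k < p + q) ((k == l :> nat)%:R : R) ^+ 2 = 1.
    rewrite (bigD1 (Ordinal lpq))//= eqxx expr1n big1 ?addr0// => j.
    by rewrite -val_eqE /= => /negbTE ->; rewrite expr0n.
  rewrite mulr1; apply: le_trans.
  rewrite (eq_bigr (fun i : 'I_n.+1 => linpred s u p (p + q) (fun k => (k == l)%:R) i ^+ 2)).
    by rewrite lerDr.
  move=> i _; congr (_ ^+ 2).
  rewrite /linpred (bigD1 (Ordinal lpq))//= eqxx mul1r big1 ?addr0// => j.
  by rewrite -val_eqE /= => /negbTE ->; rewrite mul0r.
have [kp|pk] := ltnP k p.
  apply: le_trans (diag 0%N _); last by rewrite addn_gt0 p0.
  by rewrite /regressor kp p0; exact: sum_reg_le.
apply: le_trans (diag p _); last by rewrite -[X in (X < _)%N]addn0 ltn_add2l.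
by rewrite /regressor ltnNge pk ltnn subnn; exact: sum_reg_le.
Qed.

(** The residual is the rounding error of the new output plus [p0] past rounding errors weighted by
    the [a j], each error at most [eps / 2]. For [i >= p0, q0], no lag reaches time 0, which [reg]
    replaces by 0. *)
Lemma quantized_arx_residual (R : realType) (y s u w a b z : nat -> R) p0 q0 p (c eps : R) i :
  0 < eps -> (forall n, s n = quantize eps (y n)) ->
  y i.+1 = - (\sum_(1 <= j < p0.+1) a j * (if (j <= i.+1)%N then y (i.+1 - j)%N else 0))
    + (\sum_(1 <= j < q0.+1) b j * (if (j <= i.+1)%N then u (i.+1 - j)%N else 0)) + w i.+1 ->
  (forall j, (1 <= j <= p0)%N -> `|a j| <= c) -> (p0 <= p)%N ->
  (forall k, (k < p + q0)%N -> z k = theta_bar p0 a b p k) ->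
  (p0 <= i)%N -> (q0 <= i)%N ->
  `|s i.+1 - linpred s u p (p + q0) z i - w i.+1| <= (1 + p0%:R * c) * eps / 2.
Proof.
move=> e0 sE yE ac p0p zE p0i q0i.
have -> : s i.+1 - linpred s u p (p + q0) z i - w i.+1 =
    (s i.+1 - y i.+1) + \sum_(j < p0) a j.+1 * (s (i - j)%N - y (i - j)%N).
  have -> : linpred s u p (p + q0) z i =
      - \sum_(j < p0) a j.+1 * s (i - j)%N + \sum_(j < q0) b j.+1 * u (i - j)%N.
    rewrite /linpred big_split_ord/=; congr (_ + _).
      pose F k := - (if (k < p0)%N then a k.+1 else 0) * reg s i k.
      rewrite (eq_bigr (fun k : 'I_p => F k)) => [|k _]; last first.
        by rewrite zE ?ltn_addr// /theta_bar /regressor ltn_ord.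
      rewrite (@sum_widen_zero _ F p0)// => [|k p0k]; last first.
        by rewrite /F ltnNge p0k oppr0 mul0r.
      rewrite -sumrN; apply: eq_bigr => k _.
      by rewrite /F ltn_ord /reg (leq_trans (ltn_ord k)) // mulNr.
    apply: eq_bigr => k _.
    rewrite zE ?ltn_add2l// /theta_bar /regressor ltnNge leq_addr /= addKn.
    by rewrite /reg (leq_trans (ltn_ord k)).
  rewrite yE !big_add1 /= !big_mkord.
  have -> : \sum_(j < p0) a j.+1 * (if (j.+1 <= i.+1)%N then y (i.+1 - j.+1)%N else 0) =
      \sum_(j < p0) a j.+1 * y (i - j)%N.
    by apply: eq_bigr => j _; rewrite subSS ltnS (leq_trans (ltnW (ltn_ord j))).
  have -> : \sum_(j < q0) b j.+1 * (if (j.+1 <= i.+1)%N then u (i.+1 - j.+1)%N else 0) =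
      \sum_(j < q0) b j.+1 * u (i - j)%N.
    by apply: eq_bigr => j _; rewrite subSS ltnS (leq_trans (ltnW (ltn_ord j))).
  under [in RHS]eq_bigr do rewrite mulrBr.
  by rewrite sumrB; ring.
have -> : (1 + p0%:R * c) * eps / 2 = eps / 2 + \sum_(j < p0) c * (eps / 2).
  by rewrite sumr_const card_ord -mulr_natl; ring.
apply: le_trans (ler_normD _ _) _; apply: lerD; first by rewrite sE quantize_error.
apply: le_trans (ler_norm_sum _ _ _) _; apply: ler_sum => j _.
by rewrite normrM ler_pM// ?ac ?ltn_ord// sE quantize_error.
Qed.

(** * The filtration of past noise and inputs *)

Lemma cylinders_preimage T (I : choiceType) (R : realType) (X : I -> T -> R) (D : pred I)
    (k : I) (B : set R) : D k -> measurable B -> <<s cylinders X D >> (X k @^-1` B).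
Proof.
move=> Dk mB; apply: sub_sigma_algebra.
exists [:: k], (fun=> B); split => //=; first by rewrite Dk.
apply/seteqP; split => [t tB i|t]; first by rewrite /= inE => /eqP ->.
by move/(_ k); rewrite /= mem_head; exact.
Qed.

(* the noise up to time [n] together with the whole input sequence *)
Definition past (n : nat) (k : nat + nat) : bool :=
  match k with inl j => (j <= n)%N | inr _ => true end.

Section filtration.
Context d (T : measurableType d) (R : realType) (P : probability T R) (w u : nat -> T -> R).
Let X (k : nat + nat) : T -> R := match k with inl n => w n | inr n => u n end.
Let G n := cylinders X (past n).

(** The index [inl n.+1] lies outside [past n], so [mutually_independent_cylinders] applies. *)
Lemma past_innovations :
  (forall n, measurable_fun setT (w n)) -> (forall n, measurable_fun setT (u n)) ->
  (forall n, has_law P (w n) (normal_prob 0 1)) -> mutually_independent P X ->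
  innovations P G w.
Proof.
move=> mw mu lw indep; have mX k : measurable_fun setT (X k) by case: k.
split.
- by move=> n; exact: cylinders_measurable.
- move=> n; apply: sub_sigma_algebra2; apply: cylindersS => -[j|//] /= jn.
  exact: leqW.
- move=> n B mB; apply: (@cylinders_preimage _ _ _ X (past n) (inl n)) => //.
  exact: leqnn.
- move=> n A W GA mW; rewrite -(lw n.+1 W mW).
  apply: (@mutually_independent_cylinders _ _ _ _ _ X (past n) (inl n.+1)) => //.
  by rewrite /= ltnn.
Qed.

Lemma past_input j n : measurable_fun (setT : set (g_sigma_algebraType (G n))) (u j).
Proof.
apply/measurable_funG => B mB.
exact: (@cylinders_preimage _ _ _ X (past n) (inr j)).
Qed.

Lemma past_noise j n : (j <= n)%N ->
  measurable_fun (setT : set (g_sigma_algebraType (G n))) (w j).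
Proof.
move=> jn; apply/measurable_funG => B mB.
exact: (@cylinders_preimage _ _ _ X (past n) (inl j)).
Qed.

Lemma past_output (a b : nat -> R) (p0 q0 : nat) (y : nat -> T -> R) :
  (forall t, y 0%N t = w 0%N t) ->
  (forall n t, y n.+1 t =
       - (\sum_(1 <= i < p0.+1) a i * (if (i <= n.+1)%N then y (n.+1 - i)%N t else 0))
       + (\sum_(1 <= j < q0.+1) b j * (if (j <= n.+1)%N then u (n.+1 - j)%N t else 0))
       + w n.+1 t) ->
  forall n j, (j <= n)%N -> measurable_fun (setT : set (g_sigma_algebraType (G n))) (y j).
Proof.
move=> y0 yS n j; elim/ltn_ind: j => -[|j] IH jn.
  by rewrite (_ : y 0%N = w 0%N); [exact: past_noise|apply/funext].
rewrite (_ : y j.+1 = fun t =>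
    - (\sum_(i <- index_iota 0 p0) a i.+1 * (if (i <= j)%N then y (j - i)%N t else 0)) +
    (\sum_(i <- index_iota 0 q0) b i.+1 * (if (i <= j)%N then u (j - i)%N t else 0)) +
    w j.+1 t); last first.
  by apply/funext => t; rewrite yS !big_add1.
apply: measurable_funD; last exact: past_noise.
apply: measurable_funD.
  apply: measurable_funN; apply: measurable_sum => i; apply: measurable_funM => //.
  case: leqP => // ij; apply: IH; first by rewrite ltnS leq_subr.
  exact: leq_trans (leq_subr _ _) (ltnW jn).
apply: measurable_sum => i; apply: measurable_funM => //.
by case: leqP => // ij; exact: past_input.
Qed.

Lemma past_regressor (s : nat -> T -> R) p k :
  (forall n j, (j <= n)%N -> measurable_fun (setT : set (g_sigma_algebraType (G n))) (s j)) ->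
  adapted G (fun i t => regressor (s ^~ t) (u ^~ t) p i k).
Proof.
move=> ms i; apply/measurable_funG; rewrite /regressor /reg.
case: (k < p)%N.
  by case: (k < i)%N => //; exact: (ms i (i - k)%N (leq_subr _ _)).
by case: (k - p < i)%N => //; exact: past_input.
Qed.
End filtration.

Lemma ae_conj d (T : measurableType d) (R : realType) (P : {measure set T -> \bar R})
    (A B : T -> Prop) :
  {ae P, forall t, A t} -> {ae P, forall t, B t} -> {ae P, forall t, A t /\ B t}.
Proof. by apply: filterS2. Qed.

Theorem theorem2
  (R : realType) (d : measure_display) (T : measurableType d) (P : probability T R)
  (* system orders and parameters *)
  (p0 q0 pstar qstar : nat) (a b : nat -> R)
  (* noise, input, output *)
  (w u y : nat -> T -> R)
  (delta c eps c2 c4 gam beta1 beta2 : R) (v : nat -> R) :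
  (* the system, with y_n = u_n = w_n = 0 for n < 0 *)
  (forall t, y 0%N t = w 0%N t) ->
  (forall n t, y n.+1 t =
       - (\sum_(1 <= i < p0.+1) a i * (if (i <= n.+1)%N then y (n.+1 - i)%N t else 0))
       + (\sum_(1 <= j < q0.+1) b j * (if (j <= n.+1)%N then u (n.+1 - j)%N t else 0))
       + w n.+1 t) ->
  ((0 < p0)%N -> a p0 != 0) -> (* a_{p0} <> 0 (automatic when p0 = 0 since a_0 = 1) *)
  b q0 != 0 ->
  0 < eps ->
  (* noise: i.i.d. N(0,1); (A1) input i.i.d. uniform on [-delta, delta], independent of the noise *)
  (forall n, measurable_fun setT (w n)) ->
  (forall n, measurable_fun setT (u n)) ->
  (forall n, has_law P (w n) (normal_prob 0 1)) ->
  forall (Hdelta : 0 < delta),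
  (forall n, has_law P (u n) (uniform_prob (gtrN Hdelta))) ->
  mutually_independent P (fun k : nat + nat => match k with inl n => w n | inr n => u n end) ->
  (* (A2) *)
  (forall z : R[i], `|z| <= 1 -> (Apoly p0 a).[z] != 0) ->
  (* (A3) *)
  0 < c -> (forall i, (1 <= i <= p0)%N -> `|a i| <= c) ->
  (forall j, (1 <= j <= q0)%N -> `|b j| <= c) ->
  eps < 1 / (2 * (1 + p0%:R * c)) ->
  (* (A4) *)
  (0 < pstar)%N -> (0 < qstar)%N -> (p0 <= pstar)%N -> (1 <= q0 <= qstar)%N ->
  (* (A6) *)
  0 < c2 ->
  (forall q, (q <= qstar)%N ->
     {ae P, forall t, exists N, forall n, (N <= n)%N ->
        c2 * n.+1%:R <= lambda_min (fun i => quantize eps (y i t)) (fun i => u i t) pstar q n}) ->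
  (* c4 *)
  0 < c4 ->
  {ae P, forall t, exists N, forall n, (N <= n)%N ->
     lambda_max (fun i => quantize eps (y i t)) (fun i => u i t) pstar q0 n <= c4 * n.+1%:R} ->
  (* gamma' *)
  {ae P, forall t, exists N, forall n, (N <= n)%N -> forall q, (q <= q0)%N ->
     theta_tilde_norm (fun i => quantize eps (y i t)) (fun i => u i t) p0 a b pstar q0 q n <= gam} ->
  (* penalty sequence *)
  0 < beta1 -> 0 < beta2 < 1 ->
  (forall n,
     (5 * (1 + pstar%:R * c) * eps + beta1) * n%:R <= v n /\
     v n <= beta2 / qstar%:R *
       (b q0 ^+ 2 * c2 - 2 * gam * Num.sqrt (c4 * (1 + pstar%:R * c) * eps)
        - 3 * (1 + pstar%:R * c) * eps) * n%:R) ->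
  (* conclusion: almost surely, eventually every minimizer over 0 <= q <= qstar of
     V_n(pstar,q) = sigma_n(pstar,q) + v_n (pstar + q) equals q0 *)
  {ae P, forall t, exists N, forall n, (N <= n)%N -> forall q, (q <= qstar)%N ->
     (forall q', (q' <= qstar)%N ->
        sigma (fun i => quantize eps (y i t)) (fun i => u i t) pstar q n + v n * (pstar + q)%:R
        <= sigma (fun i => quantize eps (y i t)) (fun i => u i t) pstar q' n + v n * (pstar + q')%:R) ->
     q = q0}.
Proof.
move=> y0 yS _ bq0 eps0 mw mu lw Hdelta _ indep _ c0 ac _ epsc pst0 _ p0p /andP[q00 q0s] c20
  Hmin c40 Hmax Hgam beta10 beta201 Hv.
set h := (1 + pstar%:R * c) * eps.
have h0 : 0 < h.
  by rewrite mulr_gt0// ltr_wpDr// mulr_ge0// ltW.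
pose s i t := quantize eps (y i t).
(* Cut off beyond [pstar + q0], since [b] is arbitrary past [q0]. *)
pose z0 k := if (k < pstar + q0)%N then theta_bar p0 a b pstar k else 0.
have HG := past_innovations mw mu lw indep.
have my := past_output y0 yS.
have ms n j : (j <= n)%N -> measurable_fun
    (setT : set (g_sigma_algebraType (cylinders (fun k : nat + nat =>
      match k with inl n => w n | inr n => u n end) (past n)))) (s j).
  by move=> jn; apply: (measurableT_comp (measurable_quantize eps0)); exact: my.
have lln k := innovations_lln HG (past_regressor pstar k ms).
(* Vacuous instances for [q > qstar] allow a countable intersection over all [q]. *)
have {}Hmin : {ae P, forall t, forall q, (q <= qstar)%N -> exists N, forall n, (N <= n)%N ->
    c2 * n.+1%:R <= lambda_min (s ^~ t) (u ^~ t) pstar q n}.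
  apply: ae_foralln => q; have [qs|qs] := leqP q qstar.
    by apply: filterS (Hmin q qs) => t Ht _.
  exact: filterE.
move: (ae_conj (ae_conj (ae_foralln lln) Hmin) (ae_conj Hmax Hgam)).
apply: filterS => t [[{}lln {}Hmin] [{}Hmax {}Hgam]].
(* Defined as the remainder, so the regression identity is immediate and only its energy needs an
   estimate. *)
pose eta i := s i.+1 t - linpred (s ^~ t) (u ^~ t) pstar (pstar + q0) z0 i - w i.+1 t.
have h1 : (1 + p0%:R * c) * eps < 2^-1.
  have d0 : 0 < 1 + p0%:R * c by rewrite ltr_wpDr// mulr_ge0// ltW.
  move: epsc; rewrite ltr_pdivlMr ?mulr_gt0//; lra.
have h1h : (1 + p0%:R * c) * eps <= h.
  by rewrite ler_wpM2r ?(ltW eps0)// lerD2l ler_wpM2r ?(ltW c0)// ler_nat.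
apply: (@order_consistency R (s ^~ t) (u ^~ t) (w ^~ t) eta z0 v pstar q0 qstar c2 c4 h gam
  (b q0) beta1 beta2) => //.
- by rewrite q00.
- by move=> k pk; rewrite /z0 ltnNge pk.
- have pq : ((pstar + q0).-1 < pstar + q0)%N by rewrite prednK// addn_gt0 pst0.
  rewrite /z0 pq /theta_bar -(prednK q00) addnS /= ltnNge leq_addr /= addKn.
  by [].
- by move=> i; rewrite /eta; ring.
- pose g := (1 + p0%:R * c) * eps.
  have g0 : 0 <= g by rewrite mulr_ge0 ?(ltW eps0)// addr_ge0// mulr_ge0// ltW.
  apply: (@eventually_sum_le _ (fun i => eta i ^+ 2) (maxn p0 q0) ((g / 2) ^+ 2)).
  + by move=> i; exact: sqr_ge0.
  + move=> i; rewrite geq_max => /andP[p0i q0i].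
    rewrite -[eta i ^+ 2]real_normK ?num_real// ler_pXn2r ?nnegrE ?divr_ge0//.
    apply: (@quantized_arx_residual _ (y ^~ t) (s ^~ t) (u ^~ t) (w ^~ t) a b) => //.
    by move=> k kp; rewrite /z0 kp.
  + exact: sqr_ge0.
  (* From [g < 1 / 2] and [g <= h]: [(g / 2)^2 <= g / 8 < h]. *)
  + rewrite -/g in h1 h1h; nra.
- move=> k kp e e0; apply: lln e0.
  exact: sum_regressor_le Hmax.
- move: Hgam => [N HN]; exists N => n /HN Hn q /Hn; rewrite /theta_tilde_norm.
  apply: le_trans; rewrite le_eqVlt; apply/orP; left; apply/eqP.
  by congr Num.sqrt; apply: eq_bigr => k _; rewrite /z0 ltn_ord.
- move=> n; have [] := Hv n; rewrite -!(mulrA _ _ eps) -/h.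
  by [].
Qed.
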